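(* Let $\mathcal{X}$ be a separable Hilbert space with a fixed Hilbert basis $\{\Psi_j\}_{j\ge 1}$, and let $(X,Y)$ be a random pair with $X$ in $\mathcal{X}$ and $Y$ in $\{-1,1\}$. Assume that $X$ takes its values in a bounded subset $B$ of $\mathcal{X}$. For each $d\ge 1$ let $\mathcal{J}_d$ be a set of kernels on $\mathbb{R}^d$, let $\mathcal{C}_d$ be a real number, and let $\lambda_d\ge 0$ be a penalty term. Let $(l_N)$ be the sequence of training set sizes, with $l_N$ an integer and $1\le l_N<N$. Suppose that for every $d\ge 1$: (i) $\mathcal{J}_d$ is a finite set; (ii) there exists $K_d\in\mathcal{J}_d$ such that $K_d$ is universal and there exists $\nu_d>0$ with $\mathcal{N}(K_d,\epsilon)=\mathcal{O}(\epsilon^{-\nu_d})$ (as $\epsilon\to 0$); (iii) $\mathcal{C}_d>1$. Suppose also that $$\sum_{d\ge 1}|\mathcal{J}_d|\,e^{-2\lambda_d^2}<+\infty,$$ and that $$\lim_{N\to+\infty} l_N=+\infty,\qquad \lim_{N\to+\infty}(N-l_N)=+\infty,\qquad \lim_{N\to+\infty}\frac{l_N\log(N-l_N)}{N-l_N}=0.$$ Then the functional SVM classifier $f_N=f_{a^*}$, where $a^*$ is selected in $\mathcal{A}=\bigcup_{d\ge 1}\{d\}\times\mathcal{J}_d\times[0,\mathcal{C}_d]$ by the penalized split-sample procedure described in the context, is consistent, that is, $$L f_N\xrightarrow[N\to+\infty]{}L^*.$$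
   Context: **Data and errors.** The learning sample $(x_1,y_1),\ldots,(x_N,y_N)$ consists of $N$ i.i.d. realizations of $(X,Y)$, and $(X,Y)$ is independent of the sample. For a classifier $f$ with values in $\{-1,1\}$, $Lf=\mathbb{P}(f(X)\ne Y)$. When $f=f_N$ is built from the sample, the probability is taken over both the sample and $(X,Y)$. The Bayes error is $L^*=L f^*$, where $f^*(x)=1$ if $\mathbb{P}(Y=1\mid X=x)>1/2$ and $f^*(x)=-1$ otherwise. All kernels and classification rules are understood to be measurable. **Projection.** For $d\ge1$, $V_d$ is the span of $\Psi_1,\ldots,\Psi_d$ and $P_{V_d}(x)=\sum_{j=1}^d\langle x,\Psi_j\rangle\Psi_j$. The space $V_d$ is identified with $\mathbb{R}^d$ through the coordinates $(\langle x,\Psi_1\rangle,\ldots,\langle x,\Psi_d\rangle)$. Let $\Omega_d\subset\mathbb{R}^d$ be a fixed compact set containing $P_{V_d}(B)$. **Kernels.** A kernel $K$ on $\mathbb{R}^d$ is a symmetric function $K:\mathbb{R}^d\times\mathbb{R}^d\to\mathbb{R}$ such that $\sum_{i,j}\alpha_i\alpha_jK(u_i,u_j)\ge0$ for all finite families of points $u_i\in\mathbb{R}^d$ and reals $\alpha_i$. By the Moore–Aronszajn theorem there are a Hilbert space $\mathcal{H}$ and a feature map $\phi:\mathbb{R}^d\to\mathcal{H}$ with $K(u,v)=\langle\phi(u),\phi(v)\rangle_{\mathcal{H}}$. A (continuous) kernel $K$ is *universal* if the set of functions $u\mapsto\langle w,\phi(u)\rangle_{\mathcal{H}}$, $w\in\mathcal{H}$,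 is dense (in the sup norm) in the set of continuous functions on the considered compact set $\Omega_d$. The covering number $\mathcal{N}(K,\epsilon)$ is the minimum number of balls of radius $\epsilon$ needed to cover $\Omega_d$ for the (pseudo-)metric $d_K(u,v)=\|\phi(u)-\phi(v)\|_{\mathcal{H}}$ induced by $K$. **Training procedure.** The sample is split into a training set $\{(x_i,y_i):1\le i\le l_N\}$ and a validation set $\{(x_i,y_i):l_N+1\le i\le N\}$. For each $a=(d,K,C)\in\mathcal{A}$, with $(\mathcal{H},\phi)$ associated with $K$, the soft margin SVM is trained on the projected training data. That is, $(w,b)\in\mathcal{H}\times\mathbb{R}$ (with some $\xi$) is a solution of $$\min_{w,b,\xi}\ \langle w,w\rangle_{\mathcal{H}}+C\sum_{i=1}^{l_N}\xi_i\quad\text{subject to}\quad y_i\big(\langle w,\phi(P_{V_d}(x_i))\rangle_{\mathcal{H}}+b\big)\ge1-\xi_i,\ \ \xi_i\ge0,\ \ 1\le i\le l_N,$$ and $f_a(x)=\mathrm{sign}\big(\langle w,\phi(P_{V_d}(x))\rangle_{\mathcal{H}}+b\big)$. Here $w$ is a linear combination of the $\phi(P_{V_d}(x_i))$, so $f_a(x)=\mathrm{sign}\big(\sum_{i=1}^{l_N}\alpha_i^*y_iK(P_{V_d}(x),P_{V_d}(x_i))+b^*\big)$ for suitable coefficients. The value $\mathrm{sign}(0)\in\{-1,1\}$ is fixed by convention. The validation error is $$\widehat{L}f_a=\frac{1}{N-l_N}\sum_{n=l_N+1}^N\mathbb{I}_{\{f_a(x_n)\ne y_n\}},$$ and $$a^*\in\arg\min_{a=(d,K,C)\in\mathcal{A}}\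 \widehat{L}f_a+\frac{\lambda_d}{\sqrt{N-l_N}},\qquad f_N=f_{a^*}.$$ *)

(* Defs.v *)
From HB Require Import structures.
From mathcomp Require Import all_boot all_order all_algebra.
From mathcomp Require Import all_classical all_reals all_analysis.
Set Implicit Arguments.
Unset Strict Implicit.
Unset Printing Implicit Defensive.
Import Order.TTheory GRing.Theory Num.Theory.
Import numFieldNormedType.Exports.
Local Open Scope classical_set_scope.
Local Open Scope ring_scope.

(* A real Hilbert space: a Banach space whose norm comes from an inner product. *)
Record hilbertType (R : realType) := HilbertType {
  hilbert_sort :> completeNormedModType R ;
  inner : {dot hilbert_sort for idfun} ;
  innerE : forall x : hilbert_sort, `|x| ^+ 2 = inner x x }.
Arguments inner {R} h.

Definition separable_space (T : topologicalType) : Prop :=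
  exists2 D : set T, countable D & dense D.

(* Indices are shifted by one: Psi j stands for the basis vector Psi_{j+1}. *)
Definition hilbert_basis (R : realType) (E : hilbertType R) (Psi : nat -> E)
    : Prop :=
  (forall i j, inner E (Psi i) (Psi j) = (i == j)%:R) /\
  dense [set x : E | exists n (c : nat -> R), x = \sum_(i < n) c i *: Psi i].

(* P_{V_d} x, read in R^d through its coordinates in Psi_1, ..., Psi_d. *)
Definition proj_coords (R : realType) (E : hilbertType R) (Psi : nat -> E) (d : nat)
    (x : E) : 'rV[R]_d :=
  \row_(j < d) inner E x (Psi j).

Definition borel (T : ptopologicalType) := g_sigma_algebraType (@open T).

(* Labels: true encodes +1 and false encodes -1. *)
Definition label_value (R : realType) (y : bool) : R := if y then 1 else -1.

(* The sign of t as a label; s0 is the conventional value of sign(0). *)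
Definition sign_label (R : realType) (s0 : bool) (t : R) : bool :=
  if t == 0 then s0 else 0 < t.

Notation labeled E := (borel E * bool)%type.

Section kernels.
Context {R : realType} {d : nat}.

Definition kernel_fun := 'rV[R]_d -> 'rV[R]_d -> R.

Definition psd_kernel (K : kernel_fun) : Prop :=
  (forall u v, K u v = K v u) /\
  (forall n (u : 'I_n -> 'rV[R]_d) (c : 'I_n -> R),
     0 <= \sum_(i < n) \sum_(j < n) c i * c j * K (u i) (u j)).

Definition borel_kernel (K : kernel_fun) : Prop :=
  measurable_fun [set: borel 'rV[R]_d * borel 'rV[R]_d]
    (fun uv => K uv.1 uv.2).

Definition feature_map (K : kernel_fun) (H : hilbertType R)
    (phi : 'rV[R]_d -> H) : Prop :=
  forall u v, K u v = inner H (phi u) (phi v).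

Definition universal_kernel (Om : set 'rV[R]_d) (K : kernel_fun)
    (H : hilbertType R) (phi : 'rV[R]_d -> H) : Prop :=
  continuous (fun uv : 'rV[R]_d * 'rV[R]_d => K uv.1 uv.2) /\
  (forall g : 'rV[R]_d -> R, {within Om, continuous g} ->
   forall e : R, 0 < e ->
   exists w : H, forall u, Om u -> `|inner H w (phi u) - g u| < e).

(* +oo when no finite cover exists. *)
Definition covering_number (Om : set 'rV[R]_d) (H : hilbertType R)
    (phi : 'rV[R]_d -> H) (e : R) : \bar R :=
  ereal_inf [set (n%:R)%:E | n in [set n : nat |
    exists c : 'I_n -> 'rV[R]_d, (forall i, Om (c i)) /\
      (forall u, Om u -> exists i, `|phi u - phi (c i)| <= e)]].

End kernels.
Arguments kernel_fun : clear implicits.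

Section svm.
Context {R : realType} {H : hilbertType R} {n : nat}.

Definition svm_feasible (u : 'I_n -> H) (y : 'I_n -> bool)
    (w : H) (b : R) (xi : 'I_n -> R) : Prop :=
  forall i,
    1 - xi i <= label_value R (y i) * (inner H w (u i) + b) /\ 0 <= xi i.

Definition svm_objective (C : R) (w : H) (xi : 'I_n -> R) : R :=
  inner H w w + C * \sum_(i < n) xi i.

Definition svm_solution (C : R) (u : 'I_n -> H) (y : 'I_n -> bool)
    (wb : H * R) : Prop :=
  exists xi, svm_feasible u y wb.1 wb.2 xi /\
    forall w' b' xi', svm_feasible u y w' b' xi' ->
      svm_objective C wb.1 xi <= svm_objective C w' xi'.

End svm.

(* The triples a = (d, K, C). *)
Record svm_param (R : realType) := SvmParam {
  par_dim : nat ;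
  par_ker : kernel_fun R par_dim ;
  par_reg : R }.
Arguments par_ker {R} s.

Definition param_set (R : realType) (J : forall d, set (kernel_fun R d))
    (Cmax : nat -> R) : set (svm_param R) :=
  [set a | [/\ (1 <= par_dim a)%N, J (par_dim a) (par_ker a) &
               0 <= par_reg a <= Cmax (par_dim a)]].

Definition svm_classifier (R : realType) (E : hilbertType R) (Psi : nat -> E)
    (s0 : bool) (d : nat) (H : hilbertType R) (phi : 'rV[R]_d -> H)
    (wb : H * R) (x : E) : bool :=
  sign_label s0 (inner H wb.1 (phi (proj_coords Psi d x)) + wb.2).

Definition validation_error (R : realType) (E : hilbertType R) (m : nat)
    (v : m.-tuple (labeled E)) (f : E -> bool) : R :=
  m%:R^-1 * \sum_(i < m) (f (tnth v i).1 != (tnth v i).2)%:R.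

(* The terms k+1, ..., k+n of the data sequence z_1 = z 0, z_2 = z 1, ... *)
Definition data_block (T : Type) (z : nat -> T) (k n : nat) : n.-tuple T :=
  [tuple z (k + i)%N | i < n].

Section prob.
Context {d : measure_display} {T : measurableType d} {R : realType}
  (P : probability T R).

Definition mutually_independent (I : choiceType) (d' : measure_display)
    (S : measurableType d') (Z : I -> T -> S) : Prop :=
  forall (s : seq I) (A : I -> set S), uniq s ->
    (forall i, measurable (A i)) ->
    P (\bigcap_(i in [set` s]) (Z i @^-1` A i)) =
    (\prod_(i <- s) fine (P (Z i @^-1` A i)))%:E.

Definition identically_distributed (d' : measure_display)
    (S : measurableType d') (Z Z' : T -> S) : Prop :=
  forall A, measurable A -> P (Z @^-1` A) = P (Z' @^-1` A).

(* The classifier may depend on the outcome, as one built from a sample does. *)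
Definition risk (E : Type) (X : T -> E) (Y : T -> bool) (f : T -> E -> bool)
    : \bar R :=
  P [set t | f t (X t) != Y t].

(* eta is a version of x |-> P(Y = 1 | X = x). *)
Definition cond_prob1 (E : hilbertType R) (X : {RV P >-> borel E})
    (Y : T -> bool) (eta : borel E -> R) : Prop :=
  measurable_fun setT eta /\
  forall A : set (borel E), measurable A ->
    P ((X @^-1` A) `&` [set t | Y t]) =
    (\int[distribution P X]_(x in A) (eta x)%:E)%E.

End prob.

Definition bayes_classifier (R : realType) (E : Type) (eta : E -> R) (x : E)
    : bool := 2^-1 < eta x.

(* Main.v *)
(** Estimation: put the validation set in the first column of an m x k array of
    independent draws. By exchangeability, any choice of one draw per row is an equally
    good validation set, so the risk of the selected classifier is, up to 1/k, the
    average over the k^m choices of its error on the whole array. For a fixed outcome the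
    excess of this average over the validation errors is controlled by Hoeffding's
    inequality for one uniform draw per row, whose constant exp (- 2 m u^2) is exactly
    the one that the summability of |J_d| exp (- 2 lambda_d^2) absorbs. For each (d, K)
    only (m k + 1)^(l + 1) error patterns occur on the array, since the trained decision
    functions lie in the span of the l functions K(x_i, .) and of the constants,
    whatever the value of C.

    Approximation: continuous functions of finitely many coordinates are dense in L^1,
    so by universality some d and w0 have a hinge risk close to twice the Bayes error.
    With C = r^2 / l and r fixed, the trained w has norm at most r; on the compact set
    Om_d the corresponding decision functions (with a clipped offset b) are uniformly
    bounded and equicontinuous, so the law of large numbers for finitely many small
    cells controls all their hinge risks at once. Zhang's inequality turns the hinge
    risk into a bound on the classification error. *)

Require Import Defs.
From HB Require Import structures.
From mathcomp Require Import all_boot all_order all_algebra.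
From mathcomp Require Import finmap.
From mathcomp Require Import all_classical all_reals all_analysis.
From mathcomp Require Import measurable_realfun.
From mathcomp Require Import ring lra.
Set Implicit Arguments.
Unset Strict Implicit.
Unset Printing Implicit Defensive.
Import Order.TTheory GRing.Theory Num.Theory.
Import numFieldNormedType.Exports.
Local Open Scope classical_set_scope.
Local Open Scope ring_scope.

(** * Hoeffding's inequality for one uniform draw per row of an array *)

(** The regularization constant ranges over an interval, so a union bound over the parameters is out
    of reach; only the finitely many error patterns on a finite set of points can be counted.
    Symmetrization with a single ghost sample would do this at the price of a constant smaller than
    2 in the exponent, which the assumption on the penalties does not allow. Comparing a choice with
    the mean of k draws per row keeps the full constant, and k enters only through the number of
    patterns and the error 1/k. In that comparison the choice c is the only randomness, so the
    selected parameter is free to depend on c. Dropping the cross term of (t + lambda_d / sqrt m)^2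
    splits the exponential: one factor is summed over the models, the other beats the number of
    patterns because l log m / m tends to 0. On the approximation side the obstacle is the offset b:
    nothing in the objective bounds it, and the training inputs lie in the bounded set only almost
    surely. Clipping answers the first point, a null event the second. *)

Lemma derive_ge0_le (R : realType) (f f' : R -> R) (s : R) :
  (forall x, is_derive x (1 : R) f (f' x)) -> (forall x, 0 <= x -> 0 <= f' x) ->
  0 <= s -> f 0 <= f s.
Proof.
move=> df f'0 s0.
apply: (@ger0_derive1_ndecry R f 0) => //.
- by move=> x; rewrite in_itv/= andbT => x0; rewrite derive1E derive_val f'0 // ltW.
- apply/continuous_subspaceT => x.
  by apply/differentiable_continuous/derivable1_diffP; case: (df x).
Qed.

(** The left side is the exponential moment of p - b for a Bernoulli variable b of mean p. The
    logarithm h of the ratio of the right side to the left vanishes at 0 together with h', and h'' =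
    1/4 - q(1 - q) = (1 - 2q)^2 / 4 for the tilted mean q = p exp(-x) / D(x). *)
Lemma hoeffding_two_point (R : realType) (p s : R) : 0 <= p <= 1 -> 0 <= s ->
  expR (s * p) * (1 - p + p * expR (- s)) <= expR (s ^+ 2 / 8).
Proof.
move=> /andP[p0 p1] s0.
pose D x : R := 1 - p + p * expR (- x).
have D0 x : 0 < D x.
  rewrite /D; have [->|pn0] := eqVneq p 0; first by rewrite subr0 mul0r addr0.
  by rewrite ltr_wpDl ?subr_ge0// mulr_gt0 ?expR_gt0// lt_def pn0.
have dD x : is_derive x (1 : R) D (- (p * expR (- x))).
  by rewrite /D; apply: is_derive_eq; rewrite /GRing.scale/=; ring.
pose h' x := x / 4 - p + p * expR (- x) / D x.
pose h'' x := 4^-1 + (- (p * expR (- x)) * D x + (p * expR (- x)) ^+ 2) / (D x) ^+ 2.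
have dh' x : is_derive x (1 : R) h' (h'' x).
  have H1 : is_derive x (1 : R) (fun x => (D x)^-1) (- (D x) ^- 2 *: (- (p * expR (- x)))).
    by apply: is_deriveV; rewrite ?gt_eqF.
  rewrite /h' /h''; apply: is_derive_eq; rewrite /GRing.scale/=.
  have := D0 x; set d := D x; move=> d0; field; exact: lt0r_neq0.
have h''0 x : 0 <= x -> 0 <= h'' x.
  move=> _; rewrite /h''; have := D0 x; have e0 := expR_gt0 (- x).
  rewrite /D; set e := expR (- x) => d0.
  rewrite [leRHS](_ : _ = ((1 - p - p * e) ^+ 2) / (4 * (1 - p + p * e) ^+ 2)); last first.
    by field; exact: lt0r_neq0.
  by rewrite divr_ge0 ?sqr_ge0// mulr_ge0 ?sqr_ge0.
have h'0 x : 0 <= x -> 0 <= h' x.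
  move=> x0; have := derive_ge0_le dh' h''0 x0.
  by rewrite {1}/h' /D oppr0 expR0 mulr1 mul0r subrK divr1 sub0r addNr.
pose h x := x ^+ 2 / 8 - x * p - ln (D x).
have dh x : is_derive x (1 : R) h (h' x).
  have H1 : is_derive x (1 : R) (fun x => ln (D x)) ((D x)^-1 * (- (p * expR (- x)))).
    by apply: is_derive1_comp; apply: is_derive1_ln.
  rewrite /h /h'; apply: is_derive_eq; rewrite /GRing.scale/=.
  have := D0 x; set d := D x; move=> d0; field; exact: lt0r_neq0.
have := derive_ge0_le dh h'0 s0.
rewrite {1}/h /D oppr0 expR0 mulr1 subrK ln1 subr0 mul0r subr0 expr2 mul0r mul0r.
rewrite -/(D s) /h subr_ge0 => H.
rewrite -/(D s) -[X in _ * X <= _](lnK (D0 s)) -expRD ler_expR; lra.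
Qed.

Lemma mean01 (R : realFieldType) (n : nat) (a : 'I_n -> R) :
  (forall i, 0 <= a i <= 1) -> 0 <= n%:R^-1 * \sum_(i < n) a i <= 1.
Proof.
move=> a01; rewrite mulr_ge0 ?invr_ge0 ?sumr_ge0//=; last first.
  by move=> i _; have /andP[] := a01 i.
case: n a a01 => [a _|n a a01]; first by rewrite big_ord0 mulr0.
rewrite mulrC ler_pdivrMr ?ltr0n// mul1r -[X in _ <= X%:R]card_ord -sumr_const.
by apply: ler_sum => i _; have /andP[] := a01 i.
Qed.

Section resampling.
Context {R : realType} {m k : nat}.
Implicit Types (p : {ffun 'I_m * 'I_k -> bool}) (c : {ffun 'I_m -> 'I_k}).

Definition pool_mean p : R :=
  m%:R^-1 * \sum_(i < m) (k%:R^-1 * \sum_(j < k) (p (i, j))%:R).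

Definition choice_mean p c : R := m%:R^-1 * \sum_(i < m) (p (i, c i))%:R.

Lemma pool_mean_le1 p : pool_mean p <= 1.
Proof.
suff /andP[] : 0 <= pool_mean p <= 1 by [].
by apply: mean01 => i; apply: mean01 => j; rewrite ler0n lern1 leq_b1.
Qed.

Lemma choice_mean_ge0 p c : 0 <= choice_mean p c.
Proof. by rewrite mulr_ge0 ?invr_ge0// sumr_ge0. Qed.

(** A Chernoff bound written as a count of choices; dividing by k^m gives the probability under a
    uniform choice. *)
Lemma hoeffding_count p (u : R) : (0 < m)%N -> (0 < k)%N -> 0 <= u ->
  \sum_(c : {ffun 'I_m -> 'I_k}) (u < pool_mean p - choice_mean p c)%R%:R <=
  k%:R ^+ m * expR (- 2 * m%:R * u ^+ 2).
Proof.
(* This s minimizes the Chernoff exponent - s m u + m s^2 / 8, and the minimum is - 2 m u^2. *)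
move=> m0 k0 u0; set s := 4 * u.
have mR : (0 : R) < m%:R by rewrite ltr0n.
have kR : (0 : R) < k%:R by rewrite ltr0n.
have s0 : 0 <= s by rewrite mulr_ge0.
pose q i : R := k%:R^-1 * \sum_(j < k) (p (i, j))%:R.
have q01 i : 0 <= q i <= 1.
  by apply: mean01 => j; rewrite ler0n lern1 leq_b1.
pose G i j : R := expR (s * (q i - (p (i, j))%:R)).
have GE i j : G i j = expR (s * q i) * (1 - (p (i, j))%:R + (p (i, j))%:R * expR (- s)).
  rewrite /G mulrBr expRD; congr (_ * _); case: (p (i, j)) => /=.
    by rewrite mulr1 subrr mul1r add0r.
  by rewrite mulr0 oppr0 expR0 mul0r !addr0.
have sumG i : \sum_j G i j <= k%:R * expR (s ^+ 2 / 8).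
  rewrite (eq_bigr _ (fun j _ => GE i j)) -mulr_sumr big_split/= -mulr_suml sumrB.
  rewrite sumr_const card_ord.
  have -> : \sum_(j < k) (p (i, j))%:R = k%:R * q i.
    by rewrite /q mulrA mulfV ?gt_eqF// mul1r.
  rewrite (_ : _ * _ = k%:R * (expR (s * q i) * (1 - q i + q i * expR (- s)))); last by ring.
  by rewrite ler_pM2l// hoeffding_two_point.
apply: (@le_trans _ _ (\sum_(c : {ffun 'I_m -> 'I_k})
    expR (- (s * (m%:R * u))) * \prod_i G i (c i))).
  apply: ler_sum => c _; rewrite -expR_sum -expRD.
  case: ltP => [H|_] /=; last by rewrite ltW ?expR_gt0.
  rewrite -[leLHS]expR0 ler_expR addrC -mulr_sumr -mulrBr mulr_ge0// subr_ge0.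
  rewrite sumrB mulrC -ler_pdivlMr// mulrC mulrBr; exact: ltW.
(* Independence of the rows: the sum over choices of a product is the product over rows of the
   sums. *)
rewrite -mulr_sumr -(bigA_distr_bigA (fun i j => G i j)).
have -> : - 2 * m%:R * u ^+ 2 = - (s * (m%:R * u)) + (s ^+ 2 / 8) *+ m.
  by rewrite -mulr_natl /s; field.
rewrite expRD [leRHS]mulrCA ler_pM2l ?expR_gt0// -[_ *+ m]mulr_natl expRM_natl -exprMn.
rewrite -[X in _ ^+ X]card_ord -prodr_const ler_prod// => i _.
by rewrite sumG andbT sumr_ge0// => j _; rewrite ltW ?expR_gt0.
Qed.

(** The model and the pattern both depend on c, so the union bound runs over all candidate pairs.
    The penalized excess is at most t unless the selected pair is a bad one for c, and it never
    exceeds 1, so one indicator pays for that case. *)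
Lemma selection_count (M : eqType) (ms : seq M) (Lam : M -> R)
    (pats : M -> seq {ffun 'I_m * 'I_k -> bool}) (S : nat) (t : R)
    (mu : {ffun 'I_m -> 'I_k} -> M)
    (pc : {ffun 'I_m -> 'I_k} -> {ffun 'I_m * 'I_k -> bool}) :
  (0 < m)%N -> (0 < k)%N -> 0 <= t -> (forall a, a \in ms -> 0 <= Lam a) ->
  (forall a, (size (pats a) <= S)%N) ->
  (forall c, mu c \in ms) -> (forall c, pc c \in pats (mu c)) ->
  \sum_(c : {ffun 'I_m -> 'I_k}) (pool_mean (pc c) - choice_mean (pc c) c - Lam (mu c)) <=
  k%:R ^+ m * (t + \sum_(a <- ms) S%:R * expR (- 2 * m%:R * (t + Lam a) ^+ 2)).
Proof.
move=> m0 k0 t0 Lam0 Spats mums pcp.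
apply: (@le_trans _ _ (\sum_(c : {ffun 'I_m -> 'I_k}) (t + \sum_(a <- ms) \sum_(p <- pats a)
    (t + Lam a < pool_mean p - choice_mean p c)%R%:R))).
  apply: ler_sum => c _.
  rewrite (big_rem _ (mums c))/= (big_rem _ (pcp c))/=.
  set A := _%:R; set B := \sum_(_ <- _) _; set C := \sum_(_ <- _) _.
  have B0 : 0 <= B by rewrite sumr_ge0.
  have C0 : 0 <= C by rewrite sumr_ge0// => i _; rewrite sumr_ge0.
  have := pool_mean_le1 (pc c); have := choice_mean_ge0 (pc c) c.
  have := Lam0 _ (mums c).
  by move: B0 C0; rewrite /A; case: ltP => /=; lra.
rewrite big_split/= sumr_const card_ffun !card_ord -[t *+ _]mulr_natl natrX mulrDr.
rewrite lerD2l exchange_big/= mulr_sumr big_seq [leRHS]big_seq.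
apply: ler_sum => a ams; rewrite exchange_big/=.
apply: (@le_trans _ _ (\sum_(p <- pats a) k%:R ^+ m * expR (- 2 * m%:R * (t + Lam a) ^+ 2))).
  by apply: ler_sum => p _; apply: hoeffding_count => //; rewrite addr_ge0 ?Lam0.
rewrite big_const_seq count_predT iter_addr addr0 -[_ *+ _]mulr_natl mulrCA.
apply: ler_wpM2l; first by rewrite exprn_ge0.
by apply: ler_wpM2r; rewrite ?ler_nat// ltW ?expR_gt0.
Qed.

End resampling.

(** * Hilbert spaces and the span of the training points *)

Section hilbert.
Context {R : realType} {H : hilbertType R}.
Implicit Types (u v w : H) (a : R).

Lemma innerC u v : inner H u v = inner H v u.
Proof. by have := @hermitian_subproof R H false idfun (inner H) u v; rewrite /= expr0 mul1r. Qed.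

Lemma innerDl w u v : inner H (u + v) w = inner H u w + inner H v w.
Proof. exact: linearDl. Qed.

Lemma innerDr w u v : inner H w (u + v) = inner H w u + inner H w v.
Proof. by rewrite !(innerC w) innerDl. Qed.

Lemma innerZl a u v : inner H (a *: u) v = a * inner H u v.
Proof. exact: linearZl_LR. Qed.

Lemma innerZr a u v : inner H u (a *: v) = a * inner H u v.
Proof. by rewrite !(innerC u) innerZl. Qed.

Lemma inner0l u : inner H 0 u = 0.
Proof. by rewrite -(scale0r u) innerZl mul0r. Qed.

Lemma innerBl w u v : inner H (u - v) w = inner H u w - inner H v w.
Proof. by rewrite innerDl -scaleN1r innerZl mulN1r. Qed.

Lemma innerBr w u v : inner H w (u - v) = inner H w u - inner H w v.
Proof. by rewrite !(innerC w) innerBl. Qed.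

Lemma inner_suml (I : Type) (r : seq I) (F : I -> H) v :
  inner H (\sum_(i <- r) F i) v = \sum_(i <- r) inner H (F i) v.
Proof. by elim/big_ind2: _ => [|? ? ? ? <- <-|//]; [exact: inner0l|exact: innerDl]. Qed.

Lemma inner_ge0 u : 0 <= inner H u u.
Proof. by rewrite -innerE sqr_ge0. Qed.

Lemma inner_eq0 u : inner H u u = 0 -> u = 0.
Proof. by rewrite -innerE => /eqP; rewrite sqrf_eq0 normr_eq0 => /eqP. Qed.

Lemma cauchy_schwarz u v : `|inner H u v| <= `|u| * `|v|.
Proof.
rewrite -(ler_pXn2r (n := 2)) ?nnegrE ?mulr_ge0// exprMn !innerE real_normK ?num_real//.
have [->|v0] := eqVneq v 0.
  by rewrite innerC !inner0l expr0n/= mulr0.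
have vv : 0 < inner H v v.
  by rewrite lt_def inner_ge0 andbT; apply: contra_neq v0; exact: inner_eq0.
have := inner_ge0 (inner H v v *: u - inner H u v *: v).
rewrite !(innerBl, innerBr, innerZl, innerZr) [inner H v u]innerC.
set uv := inner H u v; set v2 := inner H v v; set u2 := inner H u u => h.
by rewrite -(ler_pM2l vv) -/v2; lra.
Qed.

(** Gram-Schmidt by induction, for a family that may be linearly dependent: [u] is the part of the
    first vector orthogonal to the others. *)
Lemma orthogonal_projection (n : nat) (e : 'I_n -> H) w :
  exists c : 'I_n -> R, forall j, inner H (w - \sum_i c i *: e i) (e j) = 0.
Proof.
elim: n e w => [|n IH] e w; first by exists (fun=> 0) => -[].
pose e' i := e (lift ord0 i).
have [c cP] := IH e' w; have [b bP] := IH e' (e ord0).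
set w' := w - _ in cP; set u := e ord0 - _ in bP.
(* If [e ord0] lies in the span of the others then u = 0, the quotient is 0 by convention, and
   nothing has to be subtracted. *)
pose r := inner H w' u / inner H u u.
pose d i := if unlift ord0 i is Some j then c j - r * b j else r.
exists d.
have dE : w - \sum_i d i *: e i = w' - r *: u.
  rewrite big_ord_recl {1}/d unlift_none.
  rewrite (eq_bigr (fun i => c i *: e' i - r *: (b i *: e' i))); last first.
    by move=> i _; rewrite /d liftK scalerBl scalerA.
  rewrite sumrB -scaler_sumr /w' /u scalerBr !opprD !opprK -[RHS]addrA; congr (_ + _).
  by rewrite addrCA.
have wu : inner H (w' - r *: u) u = 0.
  rewrite innerBl innerZl /r; have [u0|u0] := eqVneq (inner H u u) 0.
    by rewrite (inner_eq0 u0) innerC !inner0l mulr0 subr0.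
  by rewrite mulfVK// subrr.
have we j : inner H (w' - r *: u) (e' j) = 0.
  by rewrite innerBl innerZl cP bP mulr0 subr0.
move=> j; rewrite dE; case: (unliftP ord0 j) => [i ->|->]; first exact: we.
have -> : e ord0 = u + \sum_i b i *: e' i by rewrite /u subrK.
rewrite innerDr wu add0r innerC inner_suml big1// => i _.
by rewrite innerZl innerC we mulr0.
Qed.

(** Replacing w by its projection v on the span changes no constraint and no slack, so optimality
    gives <w, w> <= <v, v>, and Pythagoras forces w = v. The value of C is irrelevant, C = 0
    included. *)
Lemma svm_solution_in_span (n : nat) (C : R) (u : 'I_n -> H) (y : 'I_n -> bool)
    (wb : H * R) : svm_solution C u y wb ->
  exists c : 'I_n -> R, wb.1 = \sum_i c i *: u i.
Proof.
case: wb => w b [xi [feas opt]] /=.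
have [c cP] := orthogonal_projection u w; exists c.
set v := \sum_i _ in cP *.
have wvu i : inner H w (u i) = inner H v (u i).
  by apply/eqP; rewrite -subr_eq0 -innerBl cP.
have feasv : svm_feasible u y v b xi by move=> i; rewrite -wvu; exact: feas.
have := opt _ _ _ feasv; rewrite /svm_objective /= lerD2r => le_wv.
apply/eqP; rewrite -subr_eq0; apply/eqP/inner_eq0/eqP.
rewrite eq_le inner_ge0 andbT.
have wvv : inner H (w - v) v = 0.
  by rewrite innerC inner_suml big1// => i _; rewrite innerZl innerC cP mulr0.
rewrite innerBr wvv subr0 innerBl; move: wvv; rewrite innerBl [inner H v w]innerC.
move: le_wv; lra.
Qed.

End hilbert.

(** * Sign patterns of a finite-dimensional space of functions *)

Section sign_patterns.
Context {R : realType} (s0 : bool).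

Lemma sign_labelE (c : R) : sign_label s0 c = if s0 then 0 <= c else 0 < c.
Proof.
by rewrite /sign_label le_eqVlt eq_sym; case: eqVneq => [->|]; case: s0; rewrite ?ltxx.
Qed.

Lemma sign_label_lin (a b x y : R) : 0 <= x -> 0 <= y -> 0 < x + y ->
  sign_label s0 a = sign_label s0 b ->
  sign_label s0 (x * a + y * b) = sign_label s0 b.
Proof.
move=> x0 y0 xy; rewrite !sign_labelE; case: s0.
  have [b0|b0] := leP 0 b => a0; first by rewrite addr_ge0// mulr_ge0.
  apply/negbTE; rewrite -ltNge; move/negbT: a0; rewrite -ltNge => a0.
  have [xn0|x_gt0] := leP x 0; first nra.
  nra.
have [b0|b0] := ltP 0 b => a0.
  have [xn0|x_gt0] := leP x 0; first nra.
  nra.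
apply/negbTE; rewrite -leNgt; move/negbT: a0; rewrite -leNgt => a0; nra.
Qed.

(** Gives nonnegative weights, not both zero, for combining two functions with different labels at a
    point into one that vanishes there. *)
Lemma sign_label_opposite (a b : R) : sign_label s0 a != sign_label s0 b ->
  0 < `|b| + `|a| /\ `|b| * a + `|a| * b = 0.
Proof.
rewrite /sign_label; case: (ltgtP a 0) => a0; case: (ltgtP b 0) => b0 => //.
- by move=> _; rewrite (ltr0_norm a0) (gtr0_norm b0); split; [lra|ring].
- by move=> _; rewrite b0 normr0 mul0r mulr0 (ltr0_norm a0); split; lra.
- by move=> _; rewrite (gtr0_norm a0) (ltr0_norm b0); split; [lra|ring].
- by move=> _; rewrite b0 normr0 mul0r mulr0 (gtr0_norm a0); split; lra.
- by move=> _; rewrite a0 normr0 mul0r mulr0 (ltr0_norm b0); split; lra.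
- by move=> _; rewrite a0 normr0 mul0r mulr0 (gtr0_norm b0); split; lra.
- by rewrite eqxx.
Qed.

(* Adding a point z splits a pattern in two only if some function vanishing at z
   realizes it, and these functions span a space of one dimension less. *)
Lemma sign_pattern_cover (T : Type) (D : nat) (h : 'I_D -> T -> R) (pts : seq T) :
  exists2 L : seq (seq bool), (size L <= (size pts).+1 ^ D)%N &
  forall al : 'I_D -> R,
    [seq sign_label s0 (\sum_i al i * h i z) | z <- pts] \in L.
Proof.
elim: pts D h => [|z pts IH] D h.
  by exists [:: [::]] => [|al]; rewrite ?exp1n//= inE.
case: D h => [|D] h.
  exists [:: nseq (size pts).+1 (sign_label s0 (0 : R))] => [|al]; first by rewrite expn0.
  rewrite inE; apply/eqP; elim: (pts) z => [|z' s IHs] z /=; rewrite big_ord0//.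
  by congr (_ :: _); exact: IHs.
have [L1 sL1 L1P] := IH _ h.
have [h0|] := pselect (forall k, h k z = 0).
  exists [seq sign_label s0 (0 : R) :: p | p <- L1] => [|al].
    by rewrite size_map (leq_trans sL1)// leq_exp2r.
  apply/mapP; eexists; first exact: (L1P al).
  by rewrite /= big1// => i _; rewrite h0 mulr0.
move=> /existsNP[k /eqP hk0].
(* Elimination of coordinate k: in a combination vanishing at z the coefficient of [h k] is
   determined by the others. *)
pose h' j z' := h (lift k j) z' - h (lift k j) z / h k z * h k z'.
have h'P (al : 'I_D.+1 -> R) z' : \sum_i al i * h i z = 0 ->
    \sum_i al i * h i z' = \sum_j al (lift k j) * h' j z'.
  rewrite !(bigD1_ord k)//= /h' => al0.
  under [in RHS]eq_bigr do rewrite mulrBr.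
  rewrite sumrB addrC; congr (_ + _).
  under [in RHS]eq_bigr do rewrite !mulrA.
  rewrite -!mulr_suml.
  have -> : \sum_(j < D) al (lift k j) * h (lift k j) z = - (al k * h k z).
    by apply/eqP; rewrite -addr_eq0 addrC; apply/eqP.
  by rewrite mulNr mulNr opprK mulfK.
have [L2 sL2 L2P] := IH _ h'.
pose pat (al : 'I_D.+1 -> R) := [seq sign_label s0 (\sum_i al i * h i z') | z' <- pts].
(* Each pattern is extended to z by true as soon as some function allows it, so only the false
   extension of such patterns is left to count. *)
pose bit p := `[< exists2 al, pat al = p & sign_label s0 (\sum_i al i * h i z) >].
exists ([seq bit p :: p | p <- L1] ++ [seq ~~ bit p :: p | p <- L2]) => [|al].
  (* With n points in [pts], (n + 1)^(D + 1) + (n + 1)^D = (n + 2)(n + 1)^D. *)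
  rewrite size_cat !size_map /= (leq_trans (leq_add sL1 sL2))//.
  rewrite [in leqLHS]expnS -mulSnr expnS leq_mul2l.
  by case: (D) => [|e]; [rewrite !expn0 | rewrite leq_exp2r ?leqnSn].
rewrite mem_cat /= -/(pat al).
have [bE|bNE] := eqVneq (bit (pat al)) (sign_label s0 (\sum_i al i * h i z)).
  by apply/orP; left; apply/mapP; exists (pat al); rewrite ?bE//; exact: L1P.
apply/orP; right.
have bit_true : bit (pat al).
  by apply: contraNT bNE => /negbTE bF; rewrite bF eq_sym eqbF_neg;
    apply/negP => sT; move/asboolPn: (negbT bF); apply; exists al.
move: bNE; rewrite bit_true => sF.
have /asboolP[be patE sbe] := bit_true.
have [] := @sign_label_opposite (\sum_i al i * h i z) (\sum_i be i * h i z).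
  by rewrite sbe eq_sym.
set a := \sum_i al i * _; set b := \sum_i be i * _ => ab0 abE.
(* This combination vanishes at z, and its weights are nonnegative, so it keeps the pattern common
   to [al] and [be]. *)
pose ga i := `|b| * al i + `|a| * be i.
have gaE z' : \sum_i ga i * h i z' =
    `|b| * \sum_i al i * h i z' + `|a| * \sum_i be i * h i z'.
  by rewrite !mulr_sumr -big_split; apply: eq_bigr => i _; rewrite /ga mulrDl !mulrA.
have patga : pat ga = pat al.
  rewrite -patE; move: patE; rewrite /pat; elim: (pts) => //= z' s IHs [sE /IHs ->].
  by congr (_ :: _); rewrite gaE; apply: sign_label_lin.
have -> : sign_label s0 a = ~~ bit (pat al) by rewrite bit_true; move: sF; case: sign_label.
rewrite -patga; apply/mapP; exists (pat ga) => //.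
suff -> : pat ga = [seq sign_label s0 (\sum_j ga (lift k j) * h' j z') | z' <- pts].
  exact: (L2P (fun j => ga (lift k j))).
by apply: eq_map => z'; rewrite h'P// gaE.
Qed.

End sign_patterns.

(** * Expectations of bounded functions *)

Section expectation.
Context {d : measure_display} {T : measurableType d} {R : realType}
  (P : probability T R).
Implicit Types (f g : T -> R) (b : T -> bool).

(** Bounded measurable functions are integrable under a probability and stable under the operations
    below, which settles integrability once and for all. *)
Definition bmf f := measurable_fun [set: T] f /\ exists M, forall t, `|f t| <= M.

Definition Ex f : R := \int[P]_t f t.

Definition Pr b : R := fine (P [set t | b t]).

Lemma measurable_event b : measurable_fun [set: T] b -> measurable [set t | b t].
Proof. by move=> mb; rewrite -[X in measurable X]setTI; exact: (mb _ [set true]). Qed.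

Lemma PrE b : measurable_fun [set: T] b -> P [set t | b t] = (Pr b)%:E.
Proof. by move=> /measurable_event mb; rewrite /Pr fineK// fin_num_measure. Qed.

Lemma Pr_ge0 b : 0 <= Pr b.
Proof. exact: fine_ge0. Qed.

Lemma Pr_le1 b : measurable_fun [set: T] b -> Pr b <= 1.
Proof.
by move=> mb; rewrite -lee_fin -PrE// probability_le1//; exact: measurable_event.
Qed.

Lemma bmf_integrable f : bmf f -> P.-integrable [set: T] (EFin \o f).
Proof.
move=> [mf [M fM]].
apply: (@le_integrable _ _ _ _ _ measurableT _ (EFin \o cst M)) => //.
- exact/measurable_EFinP.
- move=> t _ /=; rewrite lee_fin; apply: (le_trans (fM t)); exact: ler_norm.
- exact: finite_measure_integrable_cst.
Qed.

Lemma bmf_cst c : bmf (fun=> c).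
Proof. by split; [exact: measurable_cst|exists `|c|]. Qed.

Lemma bmfD f g : bmf f -> bmf g -> bmf (fun t => f t + g t).
Proof.
move=> [mf [M fM]] [mg [N gN]]; split; first exact: measurable_funD.
by exists (M + N) => t; rewrite (le_trans (ler_normD _ _))// lerD.
Qed.

Lemma bmfM f g : bmf f -> bmf g -> bmf (fun t => f t * g t).
Proof.
move=> [mf [M fM]] [mg [N gN]]; split; first exact: measurable_funM.
by exists (M * N) => t; rewrite normrM ler_pM.
Qed.

Lemma bmfZ c f : bmf f -> bmf (fun t => c * f t).
Proof. by move=> ?; apply: bmfM => //; exact: bmf_cst. Qed.

Lemma bmfN f : bmf f -> bmf (fun t => - f t).
Proof. by move=> /(bmfZ (- 1)); under eq_fun do rewrite mulN1r. Qed.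

Lemma bmfB f g : bmf f -> bmf g -> bmf (fun t => f t - g t).
Proof. by move=> ? ?; apply: bmfD => //; exact: bmfN. Qed.

Lemma bmf_sum (I : Type) (r : seq I) (F : I -> T -> R) :
  (forall i, bmf (F i)) -> bmf (fun t => \sum_(i <- r) F i t).
Proof.
move=> bF; elim: r => [|i r IH].
  by under eq_fun do rewrite big_nil; exact: bmf_cst.
by under eq_fun do rewrite big_cons; exact: bmfD.
Qed.

Lemma bmf_norm f : bmf f -> bmf (fun t => `|f t|).
Proof.
move=> [mf [M fM]]; split; first exact: measurableT_comp.
by exists M => t; rewrite normr_id.
Qed.

Lemma bmf_max f g : bmf f -> bmf g -> bmf (fun t => Num.max (f t) (g t)).
Proof.
move=> [mf [M fM]] [mg [N gN]]; split; first exact: measurable_maxr.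
exists (Num.max M N) => t; rewrite le_max; case: (leP (f t) (g t)) => _.
  by rewrite gN orbT.
by rewrite fM.
Qed.

Lemma bmf_bool b : measurable_fun [set: T] b -> bmf (fun t => (b t)%:R).
Proof.
move=> mb; split; last by exists 1 => t; case: (b t); rewrite ?normr1 ?normr0.
rewrite (_ : (fun _ => _) = (fun x : bool => x%:R : R) \o b)//.
exact: measurableT_comp.
Qed.

Lemma Ex_cst c : Ex (fun=> c) = c.
Proof.
have P1 : fine (P [set: T]) = 1 by rewrite probability_setT.
by rewrite /Ex Rintegral_cst// -[RHS]mulr1 -P1.
Qed.

Lemma ExD f g : bmf f -> bmf g -> Ex (fun t => f t + g t) = Ex f + Ex g.
Proof. by move=> /bmf_integrable ? /bmf_integrable ?; exact: RintegralD. Qed.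

Lemma ExZ c f : bmf f -> Ex (fun t => c * f t) = c * Ex f.
Proof. by move=> /bmf_integrable ?; exact: RintegralZl. Qed.

Lemma ExN f : bmf f -> Ex (fun t => - f t) = - Ex f.
Proof. by move=> bf; under eq_fun do rewrite -mulN1r; rewrite ExZ// mulN1r. Qed.

Lemma ExB f g : bmf f -> bmf g -> Ex (fun t => f t - g t) = Ex f - Ex g.
Proof. by move=> bf bg; rewrite ExD ?ExN//; exact: bmfN. Qed.

Lemma Ex_sum (I : Type) (r : seq I) (F : I -> T -> R) :
  (forall i, bmf (F i)) -> Ex (fun t => \sum_(i <- r) F i t) = \sum_(i <- r) Ex (F i).
Proof.
move=> bF; elim: r => [|i r IH].
  by under eq_fun do rewrite big_nil; rewrite big_nil Ex_cst.
under eq_fun do rewrite big_cons.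
by rewrite big_cons ExD ?IH//; exact: bmf_sum.
Qed.

Lemma Ex_le f g : bmf f -> bmf g -> (forall t, f t <= g t) -> Ex f <= Ex g.
Proof. by move=> /bmf_integrable ? /bmf_integrable ? fg; exact: le_Rintegral. Qed.

Lemma Ex_ge0 f : (forall t, 0 <= f t) -> 0 <= Ex f.
Proof. by move=> f0; exact: Rintegral_ge0. Qed.

Lemma Ex_bool b : measurable_fun [set: T] b -> Ex (fun t => (b t)%:R) = Pr b.
Proof.
move=> /measurable_event mb.
have E1 : (\int[P]_t (\1_[set t | b t] t)%:E)%E = P [set t | b t].
  by rewrite integral_indic ?setIT.
rewrite /Ex /Rintegral /Pr -E1; congr fine; apply: eq_integral => t _.
rewrite indicE (_ : (t \in _) = b t)//.
by apply/idP/idP; rewrite inE.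
Qed.

Lemma Ex_bounded_cvg (F : nat -> T -> R) f (M : R) :
  (forall n, measurable_fun [set: T] (F n)) -> measurable_fun [set: T] f ->
  (forall n t, `|F n t| <= M) -> (forall t, F ^~ t @ \oo --> f t) ->
  (fun n => Ex (F n)) @ \oo --> Ex f.
Proof.
move=> mF mf FM Ff.
have [||_ _ H] := @dominated_convergence _ _ _ P _ measurableT
  (fun n => EFin \o F n) (EFin \o f) (EFin \o cst M)
  (fun n => (measurable_EFinP _ _).2 (mF n)) ((measurable_EFinP _ _).2 mf)
  _ (finite_measure_integrable_cst P M measurableT).
- by apply: aeW => t _ /=; apply: cvg_EFin; [exact: nearW|exact: Ff].
- by apply: aeW => t n _ /=; rewrite lee_fin.
rewrite /Ex /Rintegral; apply: fine_cvg; rewrite fineK; last first.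
  apply: integrable_fin_num => //; apply: bmf_integrable; split => //.
  exists M => t; rewrite -[leLHS](cvg_lim _ (cvg_norm (Ff t)))//.
  apply: limr_le; last by apply: nearW => n /=.
  by apply/cvg_ex; exists `|f t|; apply: cvg_norm; exact: Ff.
exact: H.
Qed.

End expectation.

(** * Independent and identically distributed samples *)

Section tuple_sigma_algebra.
Context {d : measure_display} {S : measurableType d} {n : nat}.

Definition tuple_box (A : 'I_n -> set S) : set (n.-tuple S) :=
  [set w | forall i, A i (tnth w i)].

Definition tuple_boxes : set (set (n.-tuple S)) :=
  [set C | exists2 A, (forall i, measurable (A i)) & C = tuple_box A].

Lemma measurable_tuple_box A : (forall i, measurable (A i)) -> measurable (tuple_box A).
Proof.
move=> mA; rewrite (_ : tuple_box A = \bigcap_(i in [set: 'I_n]) ((@tnth n S ^~ i) @^-1` A i)).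
  apply: fin_bigcap_measurable => // i _.
  by rewrite -[X in measurable X]setTI; exact: measurable_tnth.
by apply/seteqP; split => [w wA i _|w wA i]; exact: wA.
Qed.

Lemma tuple_boxesT : tuple_boxes setT.
Proof. by exists (fun=> setT) => //; apply/seteqP; split. Qed.

Lemma measurable_tupleE : @measurable _ (n.-tuple S) = <<s tuple_boxes >>.
Proof.
apply/seteqP; split.
  apply: smallest_sub; first exact: smallest_sigma_algebra.
  move=> C; rewrite -bigcup_seq => -[i _ [B mB <-]]; apply: sub_sigma_algebra.
  exists (fun j => if j == i then B else setT); first by move=> j; case: ifP.
  rewrite setTI; apply/seteqP; split => [w /= wB j|w wB] /=.
    by case: eqP => [->|].
  by have := wB i; rewrite eqxx.
apply: smallest_sub; first exact: sigma_algebra_measurable.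
by move=> _ [A mA ->]; exact: measurable_tuple_box.
Qed.

Lemma tuple_measure_unique (R : realType) (m1 m2 : {measure set (n.-tuple S) -> \bar R}) :
  (forall A, (forall i, measurable (A i)) -> m1 (tuple_box A) = m2 (tuple_box A)) ->
  (m1 setT < +oo)%E -> forall C, measurable C -> m1 C = m2 C.
Proof.
move=> m12 m1T C mC; apply: (measure_unique tuple_boxes (fun=> setT)) => //.
- exact: measurable_tupleE.
- move=> _ _ [A mA ->] [B mB ->]; exists (fun i => A i `&` B i).
    by move=> i; exact: measurableI.
  apply/seteqP; split => [w [wA wB] i|w wAB]; first by split.
  by split => i; have [] := wAB i.
- by move=> _; exact: tuple_boxesT.
- by apply/seteqP; split => // w _; exists 0%N.
- by move=> _ [A mA ->]; exact: m12.
Qed.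

End tuple_sigma_algebra.

Section iid.
Context {d : measure_display} {T : measurableType d} {R : realType}
  (P : probability T R) {d' : measure_display} {S : measurableType d'}
  {I : choiceType} (Z : I -> T -> S).
Hypotheses (mZ : forall i, measurable_fun [set: T] (Z i))
  (idZ : forall i j, identically_distributed P (Z i) (Z j))
  (indZ : mutually_independent P Z).

Definition sample n (idx : 'I_n -> I) (t : T) : n.-tuple S := [tuple Z (idx k) t | k < n].

Lemma tnth_sample n (idx : 'I_n -> I) t k : tnth (sample idx t) k = Z (idx k) t.
Proof. by rewrite tnth_mktuple. Qed.

Lemma measurable_sample n (idx : 'I_n -> I) : measurable_fun [set: T] (sample idx).
Proof.
apply/measurable_fun_tnthP => k.
by rewrite (_ : _ \o _ = Z (idx k))//; apply/funext => t /=; rewrite tnth_sample.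
Qed.

Lemma preimage_measurable (U : set S) i : measurable U -> measurable (Z i @^-1` U).
Proof. by move=> mU; rewrite -[X in measurable X]setTI; exact: mZ. Qed.

Lemma indep_finType (J : finType) (idx : J -> I) (A : J -> set S) : injective idx ->
  (forall j, measurable (A j)) ->
  P [set t | forall j, A j (Z (idx j) t)] = (\prod_j fine (P (Z (idx j) @^-1` A j)))%:E.
Proof.
move=> inj mA.
(* Mutual independence asks for one set per index of I: A is transported along [idx] and completed
   by the whole space. *)
pose A' i := if [pick j | idx j == i] is Some j then A j else setT.
have A'E j : A' (idx j) = A j.
  rewrite /A'; case: pickP => [j' /eqP /inj -> //|/(_ j)]; by rewrite eqxx.
have mA' i : measurable (A' i) by rewrite /A'; case: pickP.
have uniq_idx : uniq [seq idx j | j <- enum J] by rewrite map_inj_uniq ?enum_uniq.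
have := indZ uniq_idx mA'; rewrite big_map big_enum/=.
under eq_bigr do rewrite A'E.
move=> <-; congr (P _); apply/seteqP; split => [t tA i /= /mapP[j _ ->]|t tA j].
  by rewrite A'E; exact: tA.
by have := tA (idx j); rewrite /= A'E; apply; rewrite /= map_f// mem_enum.
Qed.

Definition law (i : I) (U : set S) : R := fine (P (Z i @^-1` U)).

Lemma law_eq i j U : measurable U -> law i U = law j U.
Proof. by move=> mU; rewrite /law (idZ i j mU). Qed.

Lemma sample_box n (idx : 'I_n -> I) (A : 'I_n -> set S) i0 : injective idx ->
  (forall j, measurable (A j)) ->
  P (sample idx @^-1` tuple_box A) = (\prod_j law i0 (A j))%:E.
Proof.
move=> inj mA; under eq_bigr => j _ do rewrite (@law_eq i0 (idx j) _ (mA j)).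
rewrite -indep_finType//; congr (P _); apply/seteqP.
by split => [t tA j|t tA j] /=; have := tA j; rewrite tnth_sample.
Qed.

(** Both laws give a box the same product of marginal probabilities, and the boxes form a generating
    class stable under intersection. *)
Lemma exchangeable n (idx idx' : 'I_n -> I) (C : set (n.-tuple S)) :
  injective idx -> injective idx' -> measurable C ->
  P (sample idx @^-1` C) = P (sample idx' @^-1` C).
Proof.
(* Without coordinates there is no index at hand to name the common marginal law. *)
case: n idx idx' C => [|n] idx idx' C inj inj' mC.
  by congr (P _); apply/seteqP; split => t;
    rewrite /preimage/= [sample idx t]tuple0 [sample idx' t]tuple0.
pose m1 := [the {measure set _ -> \bar R} of distribution P
  (HB.pack (sample idx) (isMeasurableFun.Build _ _ _ _ _ (measurable_sample idx)))].
pose m2 := [the {measure set _ -> \bar R} of distribution P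
  (HB.pack (sample idx') (isMeasurableFun.Build _ _ _ _ _ (measurable_sample idx')))].
apply: (@tuple_measure_unique _ _ _ _ m1 m2) => //.
  by move=> A mA; rewrite /m1 /m2 /= /distribution /pushforward/= !(@sample_box _ _ _ (idx ord0)).
by rewrite /m1 /= /distribution /pushforward /= preimage_setT probability_setT ltry.
Qed.

(** For fixed U both sides are finite measures in C. They agree on boxes, since a box together with
    U is a family of sets indexed by [option 'I_n]. *)
Lemma sample_indep n (idx : 'I_n -> I) o (C : set (n.-tuple S)) (U : set S) :
  injective idx -> (forall k, idx k != o) -> measurable C -> measurable U ->
  P ((sample idx @^-1` C) `&` (Z o @^-1` U)) =
  (P (sample idx @^-1` C) * P (Z o @^-1` U))%E.
Proof.
move=> inj idxo mC mU.
have mZU := preimage_measurable o mU.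
pose Q := [the {measure set _ -> \bar R} of mrestr P mZU].
pose m1 := measure_function_pushforward__canonical__measure_function_Measure
  Q (measurable_sample idx).
have r0 : 0 <= law o U by rewrite fine_ge0.
pose m2 := [the {measure set _ -> \bar R} of mscale (NngNum r0) (distribution P
  (HB.pack (sample idx) (isMeasurableFun.Build _ _ _ _ _ (measurable_sample idx))))].
have lawE V : measurable V -> P (Z o @^-1` V) = (law o V)%:E.
  by move=> mV; rewrite /law fineK// fin_num_measure//; exact: preimage_measurable.
suff /(_ C mC) : forall C, measurable C -> m1 C = m2 C.
  by rewrite /m1 /m2 /= /pushforward /mrestr /mscale /= => ->; rewrite muleC lawE.
apply: tuple_measure_unique.
  move=> A mA; rewrite /m1 /m2 /= /pushforward /mrestr /mscale /=.
  pose A' j := if j is Some k then A k else U.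
  pose idx' j := if j is Some k then idx k else o.
  have inj' : injective idx'.
    move=> [k|] [k'|] //= => [/inj ->//|/eqP|/esym/eqP]; by rewrite (negPf (idxo _)).
  have mA' j : measurable (A' j) by case: j.
  rewrite /distribution /pushforward/= (sample_box o)//.
  rewrite [X in P X](_ : _ = [set t | forall j, A' j (Z (idx' j) t)]); last first.
    apply/seteqP; split => [t [tA tU] [k|]//=|t tA].
      by have := tA k; rewrite tnth_sample.
    by split => [k|]; [rewrite tnth_sample; exact: (tA (Some k))|exact: (tA None)].
  rewrite (indep_finType inj' mA') -EFinM; congr (_%:E).
  rewrite (bigD1 None)//= (reindex_omap Some id)//=; last by case.
  congr (_ * _); apply: eq_big => [k|k _]; first by rewrite eqxx.
  by apply: law_eq.
rewrite /m1 /= /pushforward /mrestr /= preimage_setT setTI.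
by rewrite lawE// ltry.
Qed.

(** Fubini: the sample and a further draw have the product law, and the inner probability is the
    risk of a classifier frozen at the observed sample. *)
Lemma Pr_sample n (idx : 'I_n -> I) o (G : n.-tuple S -> S -> bool) :
  injective idx -> (forall k, idx k != o) ->
  measurable_fun [set: n.-tuple S * S] (fun p => G p.1 p.2) ->
  bmf (fun t => Pr P (fun t' => G (sample idx t) (Z o t'))) /\
  Pr P (fun t => G (sample idx t) (Z o t)) =
  Ex P (fun t => Pr P (fun t' => G (sample idx t) (Z o t'))).
Proof.
move=> inj idxo mG.
pose s : {mfun T >-> n.-tuple S} :=
  HB.pack (sample idx) (isMeasurableFun.Build _ _ _ _ _ (measurable_sample idx)).
pose z : {mfun T >-> S} := HB.pack (Z o) (isMeasurableFun.Build _ _ _ _ _ (mZ o)).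
have msz : measurable_fun [set: T] (fun t => (sample idx t, Z o t)).
  by apply: measurable_fun_pair; [exact: measurable_sample|exact: mZ].
pose sz : {mfun T >-> (n.-tuple S * S)%type} :=
  HB.pack (fun t => (sample idx t, Z o t)) (isMeasurableFun.Build _ _ _ _ _ msz).
pose W : set (n.-tuple S * S) := [set p | G p.1 p.2].
have mW : measurable W by exact: (measurable_event mG).
have E1 : (distribution P s \x distribution P z)%E W = distribution P sz W.
  apply: product_measure_unique => // A B mA mB.
  rewrite /distribution /pushforward /=.
  rewrite -(sample_indep inj idxo mA mB); congr (P _).
have mGt t : measurable_fun [set: T] (fun t' => G (sample idx t) (Z o t')).
  apply: (@measurableT_comp _ _ _ _ _ _ (fun x => G (sample idx t) x)) => //.
  exact: (measurableT_comp mG (measurable_pair1 _)).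
have sec t : distribution P z (xsection W (sample idx t)) =
    (Pr P (fun t' => G (sample idx t) (Z o t')))%:E.
  rewrite -PrE// /distribution /pushforward/=; congr (P _).
  by apply/seteqP; split => t' /=; rewrite /xsection/= inE.
have mf : measurable_fun [set: T] (fun t => Pr P (fun t' => G (sample idx t) (Z o t'))).
  apply/measurable_EFinP; rewrite (_ : _ \o _ =
    (fun w => distribution P z (xsection W w)) \o sample idx); last first.
    by apply/funext => t /=; rewrite sec.
  apply: measurableT_comp; last exact: measurable_sample.
  exact: measurable_fun_xsection.
split.
  by split => //; exists 1 => t; rewrite ger0_norm ?Pr_ge0 ?Pr_le1.
transitivity (fine (distribution P sz W)); first by [].
rewrite -E1 /product_measure1 /Ex /Rintegral; congr fine.
rewrite ge0_integral_distribution//; last exact: measurable_fun_xsection.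
by apply: eq_integral => t _ /=; rewrite sec.
Qed.

(** Exchangeability for a training block, a validation block and a test point. A single index type
    makes injectivity express that the three are disjoint. *)
Lemma exchangeable_blocks a b (idx idx' : option ('I_a + 'I_b) -> I)
    (G : a.-tuple S * b.-tuple S * S -> bool) :
  injective idx -> injective idx' -> measurable_fun setT G ->
  Pr P (fun t => G (sample (idx \o Some \o inl) t, sample (idx \o Some \o inr) t,
                    Z (idx None) t)) =
  Pr P (fun t => G (sample (idx' \o Some \o inl) t, sample (idx' \o Some \o inr) t,
                    Z (idx' None) t)).
Proof.
move=> inj inj' mG; pose J := option ('I_a + 'I_b).
pose reg (w : #|{: J}|.-tuple S) : a.-tuple S * b.-tuple S * S :=
  ([tuple tnth w (enum_rank (Some (inl k) : J)) | k < a],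
   [tuple tnth w (enum_rank (Some (inr k) : J)) | k < b],
   tnth w (enum_rank (None : J))).
have mreg : measurable_fun setT reg.
  apply: measurable_fun_pair; last exact: measurable_tnth.
  apply: measurable_fun_pair; apply/measurable_fun_tnthP => k.
    rewrite (_ : _ \o _ = @tnth _ S ^~ (enum_rank (Some (inl k) : J))).
      exact: measurable_tnth.
    by apply/funext => w /=; rewrite tnth_mktuple.
  rewrite (_ : _ \o _ = @tnth _ S ^~ (enum_rank (Some (inr k) : J))).
    exact: measurable_tnth.
  by apply/funext => w /=; rewrite tnth_mktuple.
have regE (id0 : J -> I) t : reg (sample (id0 \o enum_val) t) =
    (sample (id0 \o Some \o inl) t, sample (id0 \o Some \o inr) t, Z (id0 None) t).
  rewrite /reg tnth_sample /= enum_rankK; congr (_, _, _); apply: eq_mktuple => k;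
  by rewrite tnth_sample /= enum_rankK.
have mC : measurable [set w | G (reg w)].
  exact: (measurable_event (measurableT_comp mG mreg)).
have inje (id0 : J -> I) : injective id0 -> injective (id0 \o (@enum_val J predT)).
  by move=> ?; apply: inj_comp => //; exact: enum_val_inj.
have := exchangeable (inje _ inj) (inje _ inj') mC.
rewrite /Pr => H; congr fine; move: H; rewrite /preimage /=.
under eq_fun do rewrite regE.
by under [X in _ = P X -> _]eq_fun do rewrite regE.
Qed.

End iid.

(** * The Bayes classifier and the hinge risk *)

Lemma measurable_bool2 d (T : measurableType d) (op : bool -> bool -> bool) (b1 b2 : T -> bool) :
  measurable_fun [set: T] b1 -> measurable_fun [set: T] b2 ->
  measurable_fun [set: T] (fun t => op (b1 t) (b2 t)).
Proof.
move=> m1 m2; rewrite (_ : (fun t => op _ _) = (fun t =>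
    if b1 t then (if b2 t then op true true else op true false)
    else (if b2 t then op false true else op false false))); last first.
  by apply/funext => t; case: (b1 t); case: (b2 t).
by do 2?apply: measurable_fun_ifT.
Qed.

(** The sum is the ceiling of x. It turns a bounded nonnegative function into a sum of indicators of
    level sets, up to one step. *)
Lemma ceil_count (R : realFieldType) (n : nat) (x : R) : 0 <= x -> x <= n%:R ->
  x <= \sum_(j < n) (j%:R < x)%R%:R <= x + 1.
Proof.
move=> x0; suff : (x <= n%:R -> x <= \sum_(j < n) (j%:R < x)%R%:R <= x + 1) /\
    (n%:R < x -> \sum_(j < n) (j%:R < x)%R%:R = n%:R :> R) by case.
elim: n => [|n [IH1 IH2]].
  by rewrite big_ord0 mulr0n; split => [x_le0|//]; apply/andP; split; lra.
rewrite big_ord_recr /= -natr1; case: (ltP n%:R x) => xn /=; split => [xn1|xn1].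
- by rewrite IH2//; apply/andP; split; lra.
- by rewrite IH2.
- by rewrite addr0 IH1.
- by exfalso; lra.
Qed.

Section bayes.
Context {R : realType} {E : hilbertType R} {d : measure_display} {T : measurableType d}
  (P : probability T R) (X : {RV P >-> borel E}) (Y : {RV P >-> bool})
  (eta : E -> R) (heta : cond_prob1 X Y eta).

Local Notation fs := (bayes_classifier eta : borel E -> bool).

Definition agree (t : T) : R := if Y t == fs (X t) then 1 else -1.

Lemma measurable_bayes : measurable_fun [set: borel E] fs.
Proof. by have [meta _] := heta; apply: measurable_fun_ltr => //; exact: measurable_cst. Qed.

Let mX : measurable_fun [set: T] X. Proof. by []. Qed.
Let mY : measurable_fun [set: T] Y. Proof. by []. Qed.

Lemma measurable_classif (h : borel E -> bool) : measurable_fun [set: borel E] h ->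
  measurable_fun [set: T] (fun t => h (X t)).
Proof. by move=> mh; exact: measurableT_comp. Qed.

Lemma bmf_agree : bmf agree.
Proof.
rewrite (_ : agree = fun t => -1 + 2 * (Y t == fs (X t))%:R); last first.
  by apply/funext => t; rewrite /agree; case: (Y t == _) => /=; ring.
have mfX := measurable_classif measurable_bayes.
exact: (bmfD (bmf_cst _) (bmfZ _ (bmf_bool (measurable_bool2 eq_op mY mfX)))).
Qed.

Let prob_cond (h : borel E -> bool) : measurable_fun [set: borel E] h ->
  (Pr P (fun t => h (X t) && Y t))%:E =
  (\int[distribution P X]_(x in [set x | h x]) (eta x)%:E)%E /\
  (Pr P (fun t => h (X t)))%:E = distribution P X [set x | h x].
Proof.
move=> mh; have [_ etaP] := heta; split.
  rewrite -etaP; last exact: measurable_event.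
  rewrite -PrE; last by apply: measurable_and => //; exact: measurable_classif.
  by congr (P _); apply/seteqP; split => t /andP.
by rewrite -PrE//; exact: measurable_classif.
Qed.

(** The event is cut along [fs]; on each piece the mass of Y = 1 is compared with half of the mass
    of the piece. *)
Lemma bayes_event (h : borel E -> bool) : measurable_fun [set: borel E] h ->
  Pr P (fun t => h (X t) && (Y t != fs (X t))) <=
  Pr P (fun t => h (X t) && (Y t == fs (X t))).
Proof.
move=> mh; have [meta _] := heta.
have mfs := measurable_bayes.
pose h1 x := h x && fs x; pose h2 x := h x && ~~ fs x.
have mh1 : measurable_fun [set: borel E] h1 by exact: measurable_and.
have mh2 : measurable_fun [set: borel E] h2.
  by apply: measurable_and => //; exact: measurable_neg.
have [I1 p1] := prob_cond mh1; have [I2 p2] := prob_cond mh2.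
have H1 : 2^-1 * Pr P (fun t => h1 (X t)) <= Pr P (fun t => h1 (X t) && Y t).
  rewrite -lee_fin EFinM p1 I1 -integral_cst; last exact: measurable_event.
  apply: ge0_le_integral => //; first exact: measurable_event.
  - by move=> x _; rewrite lee_fin.
  - by apply/measurable_EFinP; apply: measurable_funS meta.
  - move=> x /andP[_ fx]; rewrite lee_fin; apply: ltW; exact: fx.
have H2 : Pr P (fun t => h2 (X t) && Y t) <= 2^-1 * Pr P (fun t => h2 (X t)).
  rewrite -lee_fin EFinM p2 I2 -integral_cst; last exact: measurable_event.
  (* As a version of a conditional probability, [eta] may take negative values; its positive part is
     still at most 1/2 on this piece. *)
  apply: le_trans (_ : _ <= \int[distribution P X]_(x in _) (EFin \o eta)^\+ x)%E _.
    rewrite integralE; apply: geeDl; rewrite oppe_le0; exact: integral_ge0.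
  apply: ge0_le_integral => //; first exact: measurable_event.
  - by apply: measurable_funepos; apply/measurable_EFinP; apply: measurable_funS meta => //.
  - move=> x /andP[_]; rewrite /bayes_classifier -leNgt => fx.
    by rewrite funeposE ge_max !lee_fin fx/= invr_ge0.
have ind (b : T -> bool) (mb : measurable_fun [set: T] b) := Ex_bool P mb.
have mhX := measurable_classif mh.
have mfX := measurable_classif mfs.
have m1 : measurable_fun [set: T] (fun t => h1 (X t)) by exact: measurable_classif.
have m2 : measurable_fun [set: T] (fun t => h2 (X t)) by exact: measurable_classif.
have m1Y : measurable_fun [set: T] (fun t => h1 (X t) && Y t) by exact: measurable_and.
have m2Y : measurable_fun [set: T] (fun t => h2 (X t) && Y t) by exact: measurable_and.
have mN : measurable_fun [set: T] (fun t => h (X t) && (Y t != fs (X t))).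
  by apply: measurable_and => //; apply: (measurable_bool2 (fun a b => a != b)).
have mE : measurable_fun [set: T] (fun t => h (X t) && (Y t == fs (X t))).
  by apply: measurable_and => //; apply: (measurable_bool2 eq_op).
have E1 : Pr P (fun t => h (X t) && (Y t != fs (X t))) = Pr P (fun t => h1 (X t)) -
    Pr P (fun t => h1 (X t) && Y t) + Pr P (fun t => h2 (X t) && Y t).
  rewrite -!ind// -ExB -?ExD; do ?[exact: bmf_bool|apply: bmfB].
  congr Ex; apply/funext => t; rewrite /h1 /h2.
  by case: (h _); case: (Y t); case: (fs _) => /=; ring.
have E2 : Pr P (fun t => h (X t) && (Y t == fs (X t))) = Pr P (fun t => h1 (X t) && Y t) +
    (Pr P (fun t => h2 (X t)) - Pr P (fun t => h2 (X t) && Y t)).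
  rewrite -!ind// -ExB -?ExD; do ?[exact: bmf_bool|apply: bmfB].
  congr Ex; apply/funext => t; rewrite /h1 /h2.
  by case: (h _); case: (Y t); case: (fs _) => /=; ring.
rewrite E1 E2; move: H1 H2; lra.
Qed.

(** Given X, the mean of [agree] is |2 eta - 1|. Instead of conditioning, the proof applies
    [bayes_event] to the level sets of v. *)
Lemma bayes_agree (v : borel E -> R) (M : R) : 0 < M -> measurable_fun [set: borel E] v ->
  (forall t, 0 <= v (X t) <= M) -> 0 <= Ex P (fun t => v (X t) * agree t).
Proof.
move=> M0 mv v0M.
have bv : bmf (fun t => v (X t)).
  split; first exact: measurableT_comp.
  by exists M => t; have /andP[v0 vM] := v0M t; rewrite ger0_norm.
apply/ler_addgt0Pl => e e0.
have [n Mn] : exists n, M / n.+1%:R <= e.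
  exists (Num.truncn (M / e)).
  rewrite ler_pdivrMr ?ltr0n// mulrC -ler_pdivrMr//; apply: ltW; exact: truncnS_gt.
have n0 : 0 < n.+1%:R :> R by rewrite ltr0n.
(* S is the ceiling of (n + 1) v / M, so M / (n + 1) times S exceeds v by at most M / (n + 1) <=
   e. *)
pose S t : R := \sum_(j < n.+1) (j%:R < n.+1%:R / M * v (X t))%R%:R.
have Sv t : - (M / n.+1%:R) <= v (X t) - M / n.+1%:R * S t <= 0.
  have /andP[v0 vM] := v0M t.
  pose x := n.+1%:R / M * v (X t).
  have x0 : 0 <= x by rewrite mulr_ge0 ?divr_ge0// ltW.
  have xn : x <= n.+1%:R by rewrite /x -mulrA ler_piMr// mulrC ler_pdivrMr// mul1r.
  have := ceil_count x0 xn; rewrite -/(S t).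
  have -> : v (X t) = M / n.+1%:R * x by rewrite /x; field; rewrite !gt_eqF.
  have := divr_gt0 M0 n0; set r := M / _ => r0 /andP[Sx xS].
  by apply/andP; split; nra.
have mj (j : 'I_n.+1) : measurable_fun [set: borel E] (fun x => j%:R < n.+1%:R / M * v x).
  apply: measurable_fun_ltr; first exact: measurable_cst.
  by apply: measurable_funM => //; exact: measurable_cst.
have bj (j : 'I_n.+1) : bmf (fun t => (j%:R < n.+1%:R / M * v (X t))%R%:R : R).
  by apply: bmf_bool; exact: (measurable_classif (mj j)).
have Sa : 0 <= Ex P (fun t => S t * agree t).
  rewrite /S; under eq_fun do rewrite mulr_suml.
  rewrite Ex_sum; last by move=> j; apply: bmfM => //; exact: bmf_agree.
  apply: sumr_ge0 => j _; have := bayes_event (mj j).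
  have mh := measurable_classif (mj j).
  have mfX := measurable_classif measurable_bayes.
  have mN : measurable_fun [set: T]
      (fun t => (j%:R < n.+1%:R / M * v (X t)) && (Y t != fs (X t))).
    by apply: measurable_and => //; apply: (measurable_bool2 (fun a b => a != b)).
  have mE : measurable_fun [set: T]
      (fun t => (j%:R < n.+1%:R / M * v (X t)) && (Y t == fs (X t))).
    by apply: measurable_and => //; apply: (measurable_bool2 eq_op).
  rewrite -subr_ge0 -!Ex_bool// -ExB; do ?exact: bmf_bool.
  congr (0 <= Ex P _); apply/funext => t; rewrite /agree.
  by case: ltP => _; case: (Y t == _) => /=; ring.
have bS : bmf S by apply: bmf_sum.
have : Ex P (fun t => M / n.+1%:R * (S t * agree t) - M / n.+1%:R) <=
    Ex P (fun t => v (X t) * agree t).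
  apply: Ex_le => [||t].
  - by apply: bmfB; [apply: bmfZ; apply: bmfM|exact: bmf_cst] => //; exact: bmf_agree.
  - by apply: bmfM => //; exact: bmf_agree.
  have /andP[] := Sv t; have := divr_gt0 M0 n0; rewrite /agree; set r := M / _.
  by case: (Y t == _) => /=; rewrite ?mulr1 ?mulrN1 ?mulrN; move: (r * S t) => rS; lra.
rewrite ExB; last exact: bmf_cst; last first.
  by apply: bmfZ; apply: bmfM => //; exact: bmf_agree.
rewrite Ex_cst ExZ; last by apply: bmfM => //; exact: bmf_agree.
have : 0 <= M / n.+1%:R * Ex P (fun t => S t * agree t) by rewrite mulr_ge0 ?divr_ge0// ltW.
move: Mn; set r := M / _; move: (r * _) => rE ? ? ?; lra.
Qed.

(** The two error indicators differ by exactly [agree] where h and [fs] disagree, and by 0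
    elsewhere. *)
Lemma bayes_optimal (h : borel E -> bool) : measurable_fun [set: borel E] h ->
  Pr P (fun t => fs (X t) != Y t) <= Pr P (fun t => h (X t) != Y t).
Proof.
move=> mh; have mhX := measurable_classif mh; have mfX := measurable_classif measurable_bayes.
have m1 : measurable_fun [set: T] (fun t => fs (X t) != Y t).
  by apply: (measurable_bool2 (fun a b => a != b)).
have m2 : measurable_fun [set: T] (fun t => h (X t) != Y t).
  by apply: (measurable_bool2 (fun a b => a != b)).
pose v x : R := (h x != fs x)%:R.
have mv : measurable_fun [set: borel E] v.
  apply: (proj1 (bmf_bool _)).
  by apply: (measurable_bool2 (fun a b => a != b)) => //; exact: measurable_bayes.
have va : 0 <= Ex P (fun t => v (X t) * agree t).
  by apply: (bayes_agree ltr01 mv) => t; rewrite /v; case: (_ != _); rewrite /= ?ler01 ?lexx.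
rewrite -subr_ge0 -(Ex_bool P m1) -(Ex_bool P m2) -ExB; do ?exact: bmf_bool.
rewrite (_ : (fun t => _ - _) = (fun t => v (X t) * agree t))//; apply/funext => t.
by rewrite /v /agree; case: (h _); case: (Y t); case: (fs _) => /=; ring.
Qed.

Definition hinge (u : R) : R := Num.max 0 (1 - u).

Lemma measurable_hinge d' (T' : measurableType d') (g : T' -> R) :
  measurable_fun [set: T'] g -> measurable_fun [set: T'] (fun t => hinge (g t)).
Proof.
by move=> mg; apply: measurable_maxr; [|apply: measurable_funB]; by [].
Qed.

Lemma measurable_sign_label d' (T' : measurableType d') (s0 : bool) (g : T' -> R) :
  measurable_fun [set: T'] g -> measurable_fun [set: T'] (fun t => sign_label s0 (g t)).
Proof.
move=> mg; under eq_fun do rewrite sign_labelE.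
by case: s0; [apply: measurable_fun_ler|apply: measurable_fun_ltr].
Qed.

(** Here f is the Bayes label and g' is g oriented by it. The weight of the last sign is nonnegative
    and does not involve y, so that term has nonnegative expectation by [bayes_agree]; its two
    expressions are chosen to make all four cases hold. *)
Lemma zhang_pointwise (s0 f y : bool) (g g' : R) : g' = (if f then g else - g) ->
  (sign_label s0 g != y)%:R + (f != y)%:R <= hinge (label_value R y * g) -
    (if sign_label s0 g == f then Num.max 0 (1 - g') else Num.min 1 `|g'|) *
    (if y == f then 1 else -1).
Proof.
move=> g'E.
have sgn : if sign_label s0 g == f then 0 <= g' else g' <= 0.
  rewrite g'E /sign_label; case: f {g'E} => /=;
  by case: (ltgtP g 0) => g0; case: s0 => //=; rewrite ?oppr_ge0 ?oppr_le0 ?g0 // ltW.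
have yg : label_value R y * g = if y == f then g' else - g'.
  by rewrite g'E /label_value; case: y; case: f {g'E sgn} => /=; ring.
rewrite yg; have -> : (sign_label s0 g != y) = (sign_label s0 g == f) (+) (y == f).
  by case: (sign_label s0 g); case: f {g'E sgn yg}; case: y.
have -> : (f != y) = ~~ (y == f) by rewrite eq_sym.
move: sgn; rewrite /hinge; case: (sign_label s0 g == f) => g0; case: (y == f) => /=.
- by rewrite mulr1 subrr addr0.
- have : 1 + g' <= Num.max 0 (1 - - g') by rewrite opprK le_max lexx orbT.
  have : 1 - g' <= Num.max 0 (1 - g') by rewrite le_max lexx orbT.
  move: (Num.max _ _) (Num.max _ _) => a b; lra.
- rewrite ler0_norm// max_r ?subr_ge0; last lra.
  have : Num.min 1 (- g') <= - g' by rewrite ge_min lexx orbT.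
  move: (Num.min _ _) => a; lra.
- rewrite ler0_norm// opprK /Num.max /Num.min; do ?[case: ltP => ? /=]; lra.
Qed.

(* Zhang's inequality: the hinge risk of the Bayes classifier is twice its risk, so
   this compares the excess risk with the excess hinge risk. *)
Lemma zhang (g : borel E -> R) (s0 : bool) : measurable_fun [set: borel E] g ->
  bmf (fun t => g (X t)) ->
  Pr P (fun t => sign_label s0 (g (X t)) != Y t) + Pr P (fun t => fs (X t) != Y t) <=
  Ex P (fun t => hinge (label_value R (Y t) * g (X t))).
Proof.
move=> mg bg; have mfX := measurable_classif measurable_bayes.
have mh := measurable_sign_label s0 mg; have mhX := measurable_classif mh.
have m1 : measurable_fun [set: T] (fun t => fs (X t) != Y t).
  by apply: (measurable_bool2 (fun a b => a != b)).
have m2 : measurable_fun [set: T] (fun t => sign_label s0 (g (X t)) != Y t).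
  by apply: (measurable_bool2 (fun a b => a != b)).
pose v x : R := let g' := if fs x then g x else - g x in
  if sign_label s0 (g x) == fs x then Num.max 0 (1 - g') else Num.min 1 `|g'|.
have mg' : measurable_fun [set: borel E] (fun x => if fs x then g x else - g x).
  by apply: measurable_fun_ifT => //; [exact: measurable_bayes|exact: measurableT_comp].
have mv : measurable_fun [set: borel E] v.
  apply: measurable_fun_ifT.
  - by apply: (measurable_bool2 eq_op) => //; exact: measurable_bayes.
  - by apply: measurable_maxr => //; apply: measurable_funB.
  - by apply: measurable_minr => //; exact: measurableT_comp.
have [_ [M gM]] := bg.
have vM t : 0 <= v (X t) <= M + 1.
  have := gM t; rewrite ler_norml => /andP[g1 g2].
  rewrite /v; case: ifP => _; rewrite /Num.max /Num.min.
    by case: (fs _); case: ltP => ?; apply/andP; split; lra.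
  case: (fs _); rewrite ?normrN; have := normr_ge0 (g (X t)); have := gM t;
  by case: ltP => ? ? ?; apply/andP; split; lra.
have M1 : 0 < M + 1.
  suff : 0 <= M by lra.
  apply: le_trans (gM point); exact: normr_ge0.
have bh : bmf (fun t => hinge (label_value R (Y t) * g (X t))).
  split.
    apply: measurable_hinge; apply: measurable_funM; last exact: measurableT_comp.
    by rewrite /label_value; apply: measurable_fun_ifT.
  exists (M + 1) => t; have := gM t; rewrite ler_norml => /andP[g1 g2].
  rewrite /hinge /label_value ler_norml /Num.max.
  by case: (Y t); case: ltP => ?; apply/andP; split; lra.
have bva : bmf (fun t => v (X t) * agree t).
  apply: bmfM bmf_agree; split; first exact: measurableT_comp.
  by exists (M + 1) => t; have /andP[v0 v1] := vM t; rewrite ger0_norm.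
have va := bayes_agree M1 mv vM.
apply: (@le_trans _ _ (Ex P (fun t => hinge (label_value R (Y t) * g (X t)) - v (X t) * agree t))).
  rewrite -!Ex_bool// -ExD; do ?exact: bmf_bool.
  apply: Ex_le => [||t]; [by apply: bmfD; exact: bmf_bool|exact: bmfB|].
  exact: zhang_pointwise.
by rewrite ExB//; lra.
Qed.

End bayes.

(** * Approximation of Borel sets by continuous functions of finitely many coordinates *)

Lemma continuous_rowP (R : realType) (T : topologicalType) d (f : T -> 'rV[R]_d) :
  (forall j, continuous (fun x => f x ord0 j)) -> continuous f.
Proof.
move=> cf x A [B nB BA]; rewrite /nbhs /=.
have : \forall y \near x, forall j, B ord0 j (f y ord0 j).
  by apply: filter_forall => j; exact: (cf j x _ (nB ord0 j)).
by apply: filterS => y yB; apply: BA => i j; rewrite (ord1 i); exact: yB.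
Qed.

Lemma measurable_borel_continuous (R : realType) (T : ptopologicalType) (f : T -> R) :
  continuous f -> measurable_fun [set: borel T] f.
Proof.
move=> /continuousP cf; apply: (measurability _ (RGenOInfty.measurableE R)) => //.
move=> /= _ [_ [a ->] <-]; rewrite setTI; apply: sub_sigma_algebra; apply: cf.
exact: interval_open.
Qed.

Section hilbert_basis.
Context {R : realType} {E : hilbertType R} (Psi : nat -> E) (hPsi : hilbert_basis Psi).

Lemma inner_continuous (w : E) : continuous (fun x => inner E x w).
Proof.
move=> x; apply/cvgrPdist_le => e e0.
have k0 : 0 < `|w| + 1 by rewrite ltr_wpDl.
near=> y; rewrite -innerBl (le_trans (cauchy_schwarz _ _))//.
apply: (@le_trans _ _ (`|x - y| * (`|w| + 1))).
  by rewrite ler_wpM2l// lerDl.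
rewrite -ler_pdivlMr//.
near: y; apply: cvgr_dist_le; [exact: cvg_id|exact: divr_gt0].
Unshelve. all: by end_near. Qed.

Lemma proj_coords_continuous d : continuous (proj_coords Psi d : E -> 'rV[R]_d).
Proof.
apply: continuous_rowP => j.
rewrite (_ : (fun _ => _) = fun x => inner E x (Psi j)); first exact: inner_continuous.
by apply/funext => x; rewrite mxE.
Qed.

Definition embed d (u : 'rV[R]_d) : E := \sum_(j < d) u ord0 j *: Psi j.

Lemma embed_continuous d : continuous (@embed d).
Proof.
move=> u; apply: cvg_big => [||j _]; [exact: add_continuous|exact: nbhs_filter|].
by apply: cvgZr_tmp; [exact: nbhs_filter|exact: coord_continuous].
Qed.

Lemma embed_proj_inner d x j : (j < d)%N -> inner E (x - embed (proj_coords Psi d x)) (Psi j) = 0.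
Proof.
move=> jd; rewrite innerBl inner_suml (bigD1 (Ordinal jd))//= big1 => [|i ij].
  by rewrite innerZl mxE (proj1 hPsi) eqxx mulr1 addr0 subrr.
rewrite innerZl (proj1 hPsi) (_ : (_ == _) = false) ?mulr0//.
by apply: contraNF ij => /eqP ij; apply/eqP/val_inj.
Qed.

(** The projection is the nearest point of V_d, hence at least as near as a given element of the
    dense span once d reaches the length of that combination. *)
Lemma embed_proj_cvg x : (fun d => embed (proj_coords Psi d x)) @ \oo --> x.
Proof.
apply/cvgrPdist_lt => e e0.
have [||y [bxy [n [c yE]]]] := (proj2 hPsi) (ball x e).
- by exists x; exact: ballxx.
- exact: ball_open.
exists n => // d /= nd.
set p := embed _.
have orth z : (exists b : nat -> R, z = \sum_(j < d) b j *: Psi j) -> inner E (x - p) z = 0.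
  move=> [b ->]; rewrite innerC inner_suml big1// => j _.
  by rewrite innerZl innerC embed_proj_inner ?mulr0.
have py : inner E (x - p) (p - y) = 0.
  rewrite innerBr !orth ?subrr//.
    rewrite yE; exists (fun j => if (j < n)%N then c j else 0).
    rewrite -(big_mkord xpredT (fun j => (if (j < n)%N then c j else 0) *: Psi j)).
    rewrite (big_cat_nat _ nd)//= big_mkord [X in _ + X]big_nat_cond.
    rewrite [X in _ + X]big1 ?addr0 => [|i].
      by apply: eq_bigr => i _; rewrite ltn_ord.
    by rewrite andbT => /andP[ni _]; rewrite ltnNge ni/= scale0r.
  exists (fun j => inner E x (Psi j)); apply: eq_bigr => j _; by rewrite mxE.
have : `|x - p| ^+ 2 <= `|x - y| ^+ 2.
  rewrite !innerE (_ : x - y = (x - p) + (p - y)); last by rewrite addrA subrK.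
  move: (x - p) (p - y) py => a b ab.
  rewrite innerDr !innerDl ab [inner E b a]innerC ab addr0 add0r.
  by rewrite lerDl inner_ge0.
rewrite ler_pXn2r ?nnegrE// => /le_lt_trans; apply.
by move: bxy; rewrite -ball_normE.
Qed.

End hilbert_basis.

Section distance.
Context {R : realType} {V : normedModType R} (A : set V) (a0 : V) (Aa0 : A a0).

Definition dist_set (x : V) : R := inf [set `|x - a| | a in A].

Let dist_set_has_inf x : has_inf [set `|x - a| | a in A].
Proof. by split; [exists `|x - a0|, a0|exists 0 => _ [a _ <-]]. Qed.

Lemma dist_set_ge0 x : 0 <= dist_set x.
Proof. by apply: lb_le_inf => [|_ [a _ <-]//]; exists `|x - a0|, a0. Qed.

Lemma dist_set_le x a : A a -> dist_set x <= `|x - a|.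
Proof. by move=> Aa; apply: ge_inf; [exact: (proj2 (dist_set_has_inf x))|exists a]. Qed.

Lemma dist_set_lip x y : dist_set x <= `|x - y| + dist_set y.
Proof.
rewrite -lerBlDl; apply: lb_le_inf => [|_ [a Aa <-]]; first by exists `|y - a0|, a0.
by rewrite lerBlDl (le_trans (dist_set_le x Aa))// ler_distD.
Qed.

Lemma dist_set_continuous : continuous dist_set.
Proof.
move=> x; apply/cvgrPdist_le => e e0; near=> y.
have xy : `|x - y| <= e by near: y; apply: cvgr_dist_le => //; exact: cvg_id.
have := dist_set_lip x y; have := dist_set_lip y x; rewrite distrC => h1 h2.
by rewrite ler_norml; apply/andP; split; lra.
Unshelve. all: by end_near. Qed.

Lemma dist_set_eq0 x : A x -> dist_set x = 0.
Proof.
move=> Ax; apply/eqP; rewrite eq_le dist_set_ge0 andbT.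
by rewrite (le_trans (dist_set_le x Ax))// subrr normr0.
Qed.

Lemma dist_set_gt0 x : open (~` A) -> ~ A x -> 0 < dist_set x.
Proof.
move=> oA Ax; have /nbhs_ballP[r /= r0 rA] := open_nbhs_nbhs (conj oA Ax).
apply: lt_le_trans r0 _; apply: lb_le_inf => [|_ [a Aa <-]]; first by exists `|x - a0|, a0.
rewrite leNgt; apply/negP => xa; apply: (rA a _ Aa); by rewrite -ball_normE.
Qed.

End distance.

Lemma max_lip (R : realFieldType) (a b p q : R) :
  `|Num.max a b - Num.max p q| <= `|a - p| + `|b - q|.
Proof.
have := ler_norm (a - p); have := ler_norm (b - q).
have := ler_norm (- (a - p)); have := ler_norm (- (b - q)); rewrite !normrN.
move: `|a - p| `|b - q| => x y.
by rewrite ler_norml /Num.max; case: ltP => ?; case: ltP => ? *; apply/andP; split; lra.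
Qed.

Lemma continuous_complement (R : realType) (T : topologicalType) (g : T -> R) :
  continuous g -> continuous (fun u => 1 - g u).
Proof. by move=> cg u; apply: cvgB; [exact: cvg_cst|exact: cg]. Qed.

Section cylinder_approximation.
Context {R : realType} {E : hilbertType R} (Psi : nat -> E) (hPsi : hilbert_basis Psi)
  {d : measure_display} {T : measurableType d} (P : probability T R)
  (X : {RV P >-> borel E}).

Lemma bmf_continuous (h : E -> R) (M : R) : continuous h -> (forall x, `|h x| <= M) ->
  bmf (fun t => h (X t)).
Proof.
move=> ch hM; split; last by exists M => t.
apply: (@measurableT_comp _ _ _ _ _ _ (h : borel E -> R)) => //.
exact: measurable_borel_continuous.
Qed.

Let bmf_mem (A : set (borel E)) : measurable A -> bmf (fun t => (X t \in A)%:R : R).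
Proof.
move=> mA; apply: bmf_bool.
apply: (@measurableT_comp _ _ _ _ _ _ (fun x : borel E => x \in A)) => //.
apply: (measurable_fun_bool true); rewrite setTI.
by rewrite (_ : _ @^-1` _ = A)//; apply/seteqP; split => [x /set_mem//|x /mem_set].
Qed.

Definition cylinder_approx (A : set (borel E)) : Prop :=
  measurable A /\ forall e : R, 0 < e -> exists (n : nat) (g : 'rV[R]_n.+1 -> R),
  [/\ continuous g, (forall u, 0 <= g u <= 1) &
  Ex P (fun t => `|g (proj_coords Psi n.+1 (X t)) - (X t \in A)%:R|) <= e].

Let bmf_cyl n (g : 'rV[R]_n.+1 -> R) : continuous g -> (forall u, 0 <= g u <= 1) ->
  bmf (fun t => g (proj_coords Psi n.+1 (X t))).
Proof.
move=> cg g01; apply: (@bmf_continuous (fun x => g (proj_coords Psi n.+1 x)) 1).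
  by move=> x; apply: continuous_comp; [exact: proj_coords_continuous|exact: cg].
by move=> x; have /andP[g0 g1] := g01 (proj_coords Psi n.+1 x); rewrite ger0_norm.
Qed.

Lemma cylinder_approx0 : cylinder_approx set0.
Proof.
split => // e e0; exists 0%N, (fun=> 0); split => [|u|].
- exact: cst_continuous.
- by rewrite lexx ler01.
under eq_fun do rewrite in_set0 subrr normr0.
by rewrite Ex_cst ltW.
Qed.

Lemma cylinder_approxC A : cylinder_approx A -> cylinder_approx (~` A).
Proof.
move=> [mA hA]; split => [|e e0]; first exact: measurableC.
have [n [g [cg g01 gA]]] := hA e e0.
exists n, (fun u => 1 - g u); split => [|u|].
- exact: continuous_complement.
- by have /andP[g0 g1] := g01 u; apply/andP; split; lra.
- apply: le_trans gA; rewrite le_eqVlt; apply/orP; left; apply/eqP; congr Ex.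
  apply/funext => t; rewrite -normrN; congr `|_|; rewrite in_setC.
  by case: (X t \in A) => /=; ring.
Qed.

Let widen_continuous n m (nm : (n.+1 <= m.+1)%N) :
  continuous (fun u : 'rV[R]_m.+1 => \row_(j < n.+1) u ord0 (widen_ord nm j) : 'rV[R]_n.+1).
Proof.
apply: continuous_rowP => j.
rewrite (_ : (fun _ => _) = fun u : 'rV[R]_m.+1 => u ord0 (widen_ord nm j)).
  exact: coord_continuous.
by apply/funext => u; rewrite mxE.
Qed.

Lemma cylinder_approx_widen (A : set (borel E)) (e : R) n
    (g : 'rV[R]_n.+1 -> R) m : (n.+1 <= m.+1)%N ->
  continuous g -> (forall u, 0 <= g u <= 1) ->
  Ex P (fun t => `|g (proj_coords Psi n.+1 (X t)) - (X t \in A)%:R|) <= e ->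
  exists g' : 'rV[R]_m.+1 -> R, [/\ continuous g', (forall u, 0 <= g' u <= 1) &
    Ex P (fun t => `|g' (proj_coords Psi m.+1 (X t)) - (X t \in A)%:R|) <= e].
Proof.
move=> nm cg g01 gA.
exists (fun u => g (\row_(j < n.+1) u ord0 (widen_ord nm j))); split => //.
  by move=> u; apply: continuous_comp; [exact: widen_continuous|exact: cg].
congr (_ <= _) : gA; congr Ex; apply/funext => t; congr `|g _ - _|.
by apply/rowP => j; rewrite !mxE.
Qed.

Lemma cylinder_approxU A B : cylinder_approx A -> cylinder_approx B ->
  cylinder_approx (A `|` B).
Proof.
move=> [mA hA] [mB hB]; split => [|e e0]; first exact: measurableU.
have e2 : 0 < e / 2 by rewrite divr_gt0.
have [n1 [g1 [cg1 g101 g1A]]] := hA _ e2; have [n2 [g2 [cg2 g201 g2B]]] := hB _ e2.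
have [h1 [ch1 h101 h1A]] := cylinder_approx_widen (leq_maxl n1 n2) cg1 g101 g1A.
have [h2 [ch2 h201 h2B]] := cylinder_approx_widen (leq_maxr n1 n2) cg2 g201 g2B.
exists (maxn n1 n2), (fun u => Num.max (h1 u) (h2 u)); split => [u|u|].
- exact: (continuous_max (ch1 u) (ch2 u)).
- by have := h101 u; have := h201 u; rewrite le_max ge_max => /andP[-> ->] /andP[-> ->].
have b1 := bmf_cyl ch1 h101; have b2 := bmf_cyl ch2 h201.
have bA := bmf_mem mA; have bB := bmf_mem mB; have bAB := bmf_mem (measurableU _ _ mA mB).
rewrite (splitr e); apply: le_trans (lerD h1A h2B).
rewrite -ExD; do ?[exact: bmf_norm|apply: bmf_norm; exact: bmfB].
apply: Ex_le => [||t].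
- by apply/bmf_norm/bmfB => //; exact: bmf_max.
- by apply: bmfD; apply/bmf_norm/bmfB.
rewrite in_setU; set a := X t \in A; set b := X t \in B.
have -> : ((a || b)%:R : R) = Num.max a%:R b%:R.
  by case: a; case: b; rewrite /= ?maxxx /Num.max ?ltr01 ?ltr10.
exact: max_lip.
Qed.

(** Bounded convergence brings a finite union L^1-close to the whole union; that finite union is
    then approximated. *)
Lemma cylinder_approx_bigcup (A : nat -> set (borel E)) :
  (forall i, cylinder_approx (A i)) -> cylinder_approx (\bigcup_i A i).
Proof.
move=> hA; pose F n := \big[setU/set0]_(i < n) A i.
have hF n : cylinder_approx (F n).
  rewrite /F; elim: n => [|n IH]; first by rewrite big_ord0; exact: cylinder_approx0.
  by rewrite big_ord_recr; exact: cylinder_approxU.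
have mU : measurable (\bigcup_i A i) by apply: bigcupT_measurable => i; case: (hA i).
have mF n : measurable (F n) by case: (hF n).
split => // e e0; have e2 : 0 < e / 2 by rewrite divr_gt0.
have bFU n : bmf (fun t => `|(X t \in F n)%:R - (X t \in \bigcup_i A i)%:R| : R).
  by apply/bmf_norm/bmfB; exact: bmf_mem.
have cvgF : (fun n => Ex P (fun t => `|(X t \in F n)%:R - (X t \in \bigcup_i A i)%:R|))
    @ \oo --> Ex P (fun=> 0).
  apply: (@Ex_bounded_cvg _ _ _ _ _ _ 1).
  - by move=> n; case: (bFU n).
  - exact: measurable_cst.
  - move=> n t; rewrite normr_id; case: (_ \in _); case: (_ \in _);
    by rewrite /= ?subrr ?subr0 ?sub0r ?normrN ?normr0 ?normr1.
  - move=> t; apply: cvg_near_cst.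
    have [[i _ Ai]|nA] := pselect ((\bigcup_i A i) (X t)).
      exists i.+1 => // n /= lin.
      rewrite !mem_set ?subrr ?normr0//; first by exists i.
      by rewrite /F -bigcup_mkord; exists i.
    apply: nearW => n; rewrite !memNset ?subrr ?normr0//.
    by rewrite /F -bigcup_mkord => -[i _ Ai]; apply: nA; exists i.
move: cvgF; rewrite Ex_cst => /cvgrPdist_le /(_ _ e2) [N _ /(_ N (leqnn N))] /=.
rewrite sub0r normrN ger0_norm ?Ex_ge0// => FN.
have [n [g [cg g01 gF]]] := (proj2 (hF N)) _ e2.
exists n, g; split => //.
rewrite (splitr e); apply: le_trans (lerD gF FN).
have bg := bmf_cyl cg g01.
rewrite -ExD//; last by apply/bmf_norm/bmfB => //; exact: bmf_mem.
apply: Ex_le => [||t].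
- by apply/bmf_norm/bmfB => //; exact: bmf_mem.
- by apply: bmfD => //; apply/bmf_norm/bmfB => //; exact: bmf_mem.
exact: ler_distD.
Qed.

(** The functions min(1, n dist(x, ~U)) increase to the indicator of U; evaluating one of them at
    the projection of x on V_d leaves finitely many coordinates. *)
Lemma cylinder_approx_open (U : set E) : open U -> cylinder_approx (U : set (borel E)).
Proof.
move=> oU; have mU : measurable (U : set (borel E)) by exact: sub_sigma_algebra.
(* The distance to the complement is meaningful only when the complement is nonempty. *)
have [UT|nUT] := pselect (U = setT).
  rewrite UT -(setCK setT) setCT; apply: cylinder_approxC; exact: cylinder_approx0.
have [a0 Aa0] : (~` U) !=set0.
  by apply/set0P/eqP => UC; apply: nUT; rewrite -(setCK U) UC setC0.
split => // e e0; have e2 : 0 < e / 2 by rewrite divr_gt0.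
pose h (n : nat) x : R := Num.min 1 (n%:R * dist_set (~` U) x).
have h01 n x : 0 <= h n x <= 1.
  by rewrite /h le_min ge_min ler01 lexx/= mulr_ge0// (dist_set_ge0 Aa0).
have ch n : continuous (h n).
  move=> x; apply: (@continuous_min _ _ (fun=> 1) (fun x => n%:R * dist_set (~` U) x)).
    exact: cvg_cst.
  by apply: cvgM; [exact: cvg_cst|exact: dist_set_continuous Aa0 x].
have bh n : bmf (fun t => h n (X t)).
  by apply: (@bmf_continuous (h n) 1) => // x; have /andP[? ?] := h01 n x; rewrite ger0_norm.
have cvgh : (fun n => Ex P (fun t => `|h n (X t) - (X t \in (U : set (borel E)))%:R|))
    @ \oo --> Ex P (fun=> 0).
  apply: (@Ex_bounded_cvg _ _ _ _ _ _ 1).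
  - by move=> n; have [] := bmf_norm (bmfB (bh n) (bmf_mem mU)).
  - exact: measurable_cst.
  - move=> n t; have /andP[? ?] := h01 n (X t); rewrite normr_id ler_norml.
    by case: (_ \in _) => /=; apply/andP; split; lra.
  - move=> t; apply: cvg_near_cst.
    have [Ut|nU] := pselect (U (X t)).
      have D0 : 0 < dist_set (~` U) (X t).
        by apply: (dist_set_gt0 Aa0); rewrite ?setCK//; move=> /(_ Ut).
      exists (Num.truncn (dist_set (~` U) (X t))^-1).+1 => // n /= ln.
      rewrite mem_set//= /h min_l ?subrr ?normr0//.
      rewrite -ler_pdivrMr// mul1r (le_trans (ltW (truncnS_gt _)))// ler_nat//.
    apply: nearW => n; rewrite memNset//= subr0 /h (dist_set_eq0 Aa0)// mulr0.
    by rewrite min_r ?normr0.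
move: cvgh; rewrite Ex_cst => /cvgrPdist_le /(_ _ e2) [N _ /(_ N (leqnn N))] /=.
rewrite sub0r normrN ger0_norm ?Ex_ge0// => hN.
pose q d' (u : 'rV[R]_d') := h N (embed Psi u).
have cq d' : continuous (@q d').
  by move=> u; apply: (@continuous_comp _ _ _ (@embed _ _ Psi d') (h N));
    [exact: embed_continuous|exact: ch].
have bq d' : bmf (fun t => q d' (proj_coords Psi d' (X t))).
  apply: (@bmf_continuous (fun x => q d' (proj_coords Psi d' x)) 1).
    by move=> x; apply: continuous_comp; [exact: proj_coords_continuous|exact: cq].
  by move=> x; rewrite /q; have /andP[? ?] := h01 N (embed Psi (proj_coords Psi d' x));
    rewrite ger0_norm.
have cvgq : (fun d' => Ex P (fun t => `|q d' (proj_coords Psi d' (X t)) - h N (X t)|))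
    @ \oo --> Ex P (fun=> 0).
  apply: (@Ex_bounded_cvg _ _ _ _ _ _ 1).
  - by move=> d'; have [] := bmf_norm (bmfB (bq d') (bh N)).
  - exact: measurable_cst.
  - move=> d' t; rewrite normr_id /q; have /andP[? ?] := h01 N (X t).
    have /andP[? ?] := h01 N (embed Psi (proj_coords Psi d' (X t))).
    by rewrite ler_norml; apply/andP; split; lra.
  - move=> t; rewrite -[X in _ --> X](normr0 R) -(subrr (h N (X t))).
    apply: cvg_norm; apply: cvgB; last exact: cvg_cst.
    apply: continuous_cvg; [exact: ch|exact: embed_proj_cvg].
move: cvgq; rewrite Ex_cst => /cvgrPdist_le /(_ _ e2) [M _ /(_ M.+1 (leqnSn M))] /=.
rewrite sub0r normrN ger0_norm ?Ex_ge0// => qM.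
exists M, (q M.+1); split => // [u|]; first by rewrite /q.
rewrite (splitr e); apply: le_trans (lerD qM hN).
rewrite -ExD; last by apply/bmf_norm/bmfB => //; exact: bmf_mem.
  apply: Ex_le => [||t]; last exact: ler_distD.
  - by apply/bmf_norm/bmfB => //; exact: bmf_mem.
  - by apply: bmfD; apply/bmf_norm/bmfB => //; exact: bmf_mem.
by apply/bmf_norm/bmfB.
Qed.

Lemma cylinder_approx_measurable (A : set (borel E)) : measurable A -> cylinder_approx A.
Proof.
apply: smallest_sub; last by move=> U oU; exact: cylinder_approx_open.
split => [|B hB|B hB]; first exact: cylinder_approx0.
  by rewrite setTD; exact: cylinder_approxC.
exact: cylinder_approx_bigcup.
Qed.

End cylinder_approximation.

(** * Consistency for a fixed kernel *)

Section svm_deterministic.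
Context {R : realType} {H : hilbertType R}.
Implicit Types (w v : H) (b k r : R).

Lemma hinge_ge0 (u : R) : 0 <= hinge u.
Proof. by rewrite /hinge le_max lexx. Qed.

Lemma hinge_lip (u v : R) : `|hinge u - hinge v| <= `|u - v|.
Proof.
rewrite /hinge (le_trans (max_lip _ _ _ _))// subrr normr0 add0r.
by rewrite (_ : 1 - u - (1 - v) = - (u - v)) ?normrN//; ring.
Qed.

(** Truncates the offset, which the objective does not penalize. For k large compared with the
    linear part this keeps the label and does not increase the hinge loss. *)
Definition clip k b := Num.max (- k) (Num.min k b).

Lemma clip_norm k b : 0 <= k -> `|clip k b| <= k.
Proof.
by by move=> k0; rewrite ler_norml /clip le_max lexx/= ge_max ge_min lexx/= andbT; lra.
Qed.

Lemma sign_label_clip (s0 : bool) (a b k : R) : `|a| < k ->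
  sign_label s0 (a + clip k b) = sign_label s0 (a + b).
Proof.
rewrite ltr_norml => /andP[a1 a2].
have pos (t : R) : 0 < t -> sign_label s0 t = true.
  by move=> t0; rewrite /sign_label gt_eqF.
have neg (t : R) : t < 0 -> sign_label s0 t = false.
  by move=> t0; rewrite /sign_label lt_eqF// ltNge ltW.
rewrite /clip /Num.max /Num.min; case: (ltP k b) => kb.
  have -> : (- k < k) = true by lra.
  by rewrite !pos//; lra.
by case: (ltP (- k) b) => // bk; rewrite !neg//; lra.
Qed.

(* Clipping moves the value only where it already exceeds 1 in absolute value,
   so it can only help. *)
Lemma hinge_clip (y : bool) (a b k : R) : `|a| + 1 <= k ->
  hinge (label_value R y * (a + clip k b)) <= hinge (label_value R y * (a + b)).
Proof.
move=> ak; have := ler_norm a; have := ler_norm (- a); rewrite normrN => a1 a2.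
have k0 : 0 < k by have := normr_ge0 a; lra.
rewrite /hinge /label_value ge_max !le_max lexx /= /clip /Num.min /Num.max.
case: (ltP k b) => kb.
  have -> : (- k < k) = true by lra.
  by case: y; apply/orP; [left|right]; lra.
by case: (ltP (- k) b) => bk; case: y; apply/orP; do ?[by right; lra]; left; lra.
Qed.

Variables (n : nat) (u : 'I_n -> H) (y : 'I_n -> bool) (r : R).
Hypotheses (n0 : (0 < n)%N) (r0 : 0 < r).

Definition hinge_mean w b : R :=
  n%:R^-1 * \sum_(i < n) hinge (label_value R (y i) * (inner H w (u i) + b)).

Variables (wb : H * R).
Hypothesis sol : svm_solution (r ^+ 2 / n%:R) u y wb.

Let nR : 0 < n%:R :> R. Proof. by rewrite ltr0n. Qed.
Let C0 : 0 < r ^+ 2 / n%:R. Proof. by rewrite divr_gt0// exprn_gt0. Qed.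

(** Comparison with w = 0, b = 0 and unit slacks, whose objective is r^2. *)
Lemma svm_norm_le : `|wb.1| <= r.
Proof.
have [xi [feas opt]] := sol.
have : svm_feasible u y 0 0 (fun=> 1).
  by move=> i; rewrite inner0l addr0 mulr0 subrr lexx ler01.
move=> /opt; rewrite /svm_objective inner0l add0r sumr_const card_ord.
rewrite -[_ *+ n]mulr_natl mulr1 divfK ?gt_eqF// => le_r2.
rewrite -(ler_pXn2r (n := 2)) ?nnegrE ?(ltW r0)// innerE.
apply: le_trans le_r2; rewrite lerDl mulr_ge0 ?(ltW C0)// sumr_ge0// => i _.
by have [] := feas i.
Qed.

(** Divided by r^2, the objective is |w|^2 / r^2 plus the mean slack; the competitor is w0 with
    offset 0 and its hinge losses as slacks. *)
Lemma svm_hinge_mean_le w0 :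
  hinge_mean wb.1 wb.2 <= `|w0| ^+ 2 / r ^+ 2 + hinge_mean w0 0.
Proof.
have [xi [feas opt]] := sol.
pose xi0 i := hinge (label_value R (y i) * (inner H w0 (u i) + 0)).
have : svm_feasible u y w0 0 xi0.
  by move=> i; rewrite hinge_ge0 /xi0 /hinge lerBlDr -lerBlDl le_max lexx orbT.
move=> /opt; rewrite /svm_objective => le_obj.
have le_xi : \sum_(i < n) hinge (label_value R (y i) * (inner H wb.1 (u i) + wb.2)) <=
    \sum_(i < n) xi i.
  apply: ler_sum => i _; have [h1 h2] := feas i.
  by rewrite /hinge ge_max h2 lerBlDr -lerBlDl.
have r2 : 0 < r ^+ 2 by rewrite exprn_gt0.
rewrite /hinge_mean -(ler_pM2l r2) [leLHS]mulrA; set S0 := \sum_i _ in le_xi *.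
rewrite [leRHS](_ : _ = `|w0| ^+ 2 + r ^+ 2 / n%:R * \sum_i xi0 i); last first.
  by rewrite /xi0; field; rewrite !gt_eqF.
rewrite innerE; apply: le_trans le_obj.
apply: le_trans (_ : _ <= r ^+ 2 / n%:R * \sum_i xi i) _; last by rewrite lerDr inner_ge0.
by rewrite ler_pM2l.
Qed.

Lemma svm_clip_hinge_mean_le w0 k : (forall i, `|inner H wb.1 (u i)| + 1 <= k) ->
  hinge_mean wb.1 (clip k wb.2) <= `|w0| ^+ 2 / r ^+ 2 + hinge_mean w0 0.
Proof.
move=> hk; apply: le_trans (svm_hinge_mean_le w0).
rewrite /hinge_mean ler_pM2l ?invr_gt0//; apply: ler_sum => i _.
exact: hinge_clip.
Qed.

End svm_deterministic.

(** * A quantitative law of large numbers in mean for one event *)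

Section law_of_large_numbers.
Context {d : measure_display} {T : measurableType d} {R : realType}
  (P : probability T R) {d' : measure_display} {S : measurableType d'}
  {I : choiceType} (Z : I -> T -> S).
Hypotheses (mZ : forall i, measurable_fun [set: T] (Z i))
  (idZ : forall i j, identically_distributed P (Z i) (Z j))
  (indZ : mutually_independent P Z).
Variables (b : S -> bool) (mb : measurable_fun [set: S] b).

Let mbZ i : measurable_fun [set: T] (fun t => b (Z i t)).
Proof. exact: measurableT_comp. Qed.

Let bmfb i : bmf (fun t => (b (Z i t))%:R : R).
Proof. exact: bmf_bool. Qed.

Lemma Pr_id i j : Pr P (fun t => b (Z i t)) = Pr P (fun t => b (Z j t)).
Proof. exact: (law_eq idZ i j (measurable_event mb)). Qed.

Lemma covariance_event0 i j o : i != j ->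
  let p := Pr P (fun t => b (Z o t)) in
  Ex P (fun t => ((b (Z i t))%:R - p) * ((b (Z j t))%:R - p)) = 0.
Proof.
move=> ij p.
pose idx (e : bool) := if e then i else j.
have inj : injective idx.
  by move=> [] [] //= /eqP; rewrite ?(negPf ij)// eq_sym (negPf ij).
have pE k : fine (P (Z k @^-1` [set z | b z])) = p by exact: (Pr_id k o).
have pij : Pr P (fun t => b (Z i t) && b (Z j t)) = p * p.
  have := indep_finType indZ inj (A := fun=> [set z | b z]) (fun=> measurable_event mb).
  rewrite big_bool /= !pE => H; rewrite /Pr -[RHS]/(fine (p * p)%:E) -H; congr (fine (P _)).
  by apply/seteqP; split => [t /andP[bi bj] []//|t bij]; apply/andP; split;
    [exact: (bij true)|exact: (bij false)].
transitivity (Ex P (fun t => (b (Z i t) && b (Z j t))%:R +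
    ((- p) * (b (Z i t))%:R + ((- p) * (b (Z j t))%:R + p * p)))).
  by congr Ex; apply/funext => t; case: (b (Z i t)); case: (b (Z j t)) => /=; ring.
have bij := bmf_bool (R := R) (measurable_and (mbZ i) (mbZ j)).
have bZ k : bmf (fun t => - p * (b (Z k t))%:R) by exact: bmfZ.
have bD : bmf (fun t => - p * (b (Z j t))%:R + p * p) by apply: bmfD => //; exact: bmf_cst.
rewrite !ExD//; do ?[exact: bmf_cst|exact: bmfD].
rewrite Ex_cst !ExZ// !Ex_bool//; last exact: measurable_and.
rewrite pij (Pr_id i o) (Pr_id j o) -/p; ring.
Qed.

(** The variance bound becomes an L^1 bound through |a| <= e + a^2 / (4 e). Off-diagonal covariances
    vanish and the l diagonal terms are at most 1. *)
Lemma lln_event l (idx : 'I_l -> I) o (e : R) : (0 < l)%N -> injective idx -> 0 < e ->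
  Ex P (fun t => `|l%:R^-1 * \sum_(k < l) (b (Z (idx k) t))%:R - Pr P (fun t => b (Z o t))|)
  <= e + (4 * e * l%:R)^-1.
Proof.
move=> l0 inj e0; set p := Pr P _.
have lR : 0 < l%:R :> R by rewrite ltr0n.
pose c k t : R := (b (Z (idx k) t))%:R - p.
have bc k : bmf (c k) by apply: bmfB => //; exact: bmf_cst.
have bcc k k' : bmf (fun t => c k t * c k' t) by exact: bmfM.
have qE t : l%:R^-1 * \sum_(k < l) (b (Z (idx k) t))%:R - p = l%:R^-1 * \sum_(k < l) c k t.
  by rewrite /c sumrB sumr_const card_ord -[p *+ l]mulr_natl mulrBr mulKf ?gt_eqF.
have p0 : 0 <= p by exact: Pr_ge0.
have p1 : p <= 1 by exact: Pr_le1.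
have bS : bmf (fun t => \sum_(k < l) c k t) by exact: bmf_sum.
have bSS : bmf (fun t => \sum_(k < l) \sum_(k' < l) c k t * c k' t).
  by apply: bmf_sum => k; exact: bmf_sum.
have ESS : Ex P (fun t => \sum_(k < l) \sum_(k' < l) c k t * c k' t) <= l%:R.
  rewrite Ex_sum; last by move=> k; exact: bmf_sum.
  rewrite -[leRHS]mulr1 mulr_natl -[X in _ *+ X]card_ord -sumr_const.
  apply: ler_sum => k _; rewrite Ex_sum// (bigD1 k)//= big1 ?addr0 => [|k' kk']; last first.
    by apply: covariance_event0; rewrite (inj_eq inj) eq_sym.
  rewrite -[leRHS](Ex_cst P); apply: Ex_le => //; first exact: bmf_cst.
  by move=> t; rewrite /c; case: (b _) => /=; nra.
apply: (@le_trans _ _ (Ex P (fun t => e + (4 * e * l%:R ^+ 2)^-1 *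
    \sum_(k < l) \sum_(k' < l) c k t * c k' t))).
  apply: Ex_le => [||t].
  - apply: bmf_norm; apply: bmfB; last exact: bmf_cst.
    by apply: bmfZ; exact: bmf_sum.
  - by apply: bmfD; [exact: bmf_cst|exact: bmfZ].
  rewrite qE -[X in _ <= _ + _ * X](_ : (\sum_(k < l) c k t) ^+ 2 = _); last first.
    by rewrite expr2 mulr_suml; apply: eq_bigr => k _; rewrite mulr_sumr.
  set s := \sum_(k < l) _; rewrite normrM ger0_norm; last by rewrite invr_ge0.
  rewrite -[s ^+ 2]real_normK ?num_real//; have := normr_ge0 s; move: `|s| => a a0.
  rewrite -subr_ge0 [leRHS](_ : _ = (2 * e - l%:R^-1 * a) ^+ 2 / (4 * e)); last first.
    by field; rewrite !gt_eqF.
  by rewrite divr_ge0 ?sqr_ge0// mulr_ge0// ltW.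
rewrite ExD; [|exact: bmf_cst|exact: bmfZ].
rewrite Ex_cst ExZ// lerD2l.
have k0 : 0 < (4 * e * l%:R ^+ 2)^-1 by rewrite invr_gt0 !mulr_gt0// exprn_gt0.
apply: le_trans (_ : (4 * e * l%:R ^+ 2)^-1 * l%:R <= _); first by rewrite ler_pM2l.
rewrite le_eqVlt; apply/orP; left; apply/eqP; field; by rewrite !gt_eqF.
Qed.

End law_of_large_numbers.

(** * Uniform deviations from finitely many cells *)

Section discretization.
Context {d : measure_display} {T : measurableType d} {R : realType}
  (P : probability T R) {S : Type} (J : finType) (cell : S -> J) (z : T -> S).
Hypothesis mcell : forall j, measurable_fun [set: T] (fun t => cell (z t) == j).

Definition cell_freq l (s : l.-tuple S) j : R :=
  l%:R^-1 * \sum_(k < l) (cell (tnth s k) == j)%:R.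

Definition cell_prob j : R := Pr P (fun t => cell (z t) == j).

(** The deviation of the cell frequencies does not involve h, so controlling it once serves a whole
    family of functions, even for an h that depends on the sample. *)
Lemma empirical_mean_close (h : S -> R) (rep : J -> R) (M e : R) l (s : l.-tuple S) :
  (0 < l)%N -> 0 <= M -> (forall j, `|rep j| <= M) ->
  bmf (fun t => h (z t)) -> (forall t, `|h (z t) - rep (cell (z t))| <= e) ->
  (forall k, `|h (tnth s k) - rep (cell (tnth s k))| <= e) ->
  `|Ex P (fun t => h (z t)) - l%:R^-1 * \sum_(k < l) h (tnth s k)| <=
  2 * e + M * \sum_j `|cell_freq s j - cell_prob j|.
Proof.
move=> l0 M0 repM bh hz hs.
have lR : 0 < l%:R :> R by rewrite ltr0n.
have repE w : rep (cell w) = \sum_j (cell w == j)%:R * rep j.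
  rewrite (bigD1 (cell w))//= eqxx mul1r big1 ?addr0// => j jw.
  by rewrite eq_sym (negPf jw) mul0r.
have brep j : bmf (fun t => (cell (z t) == j)%:R * rep j : R).
  by apply: bmfM; [exact: bmf_bool|exact: bmf_cst].
have brz : bmf (fun t => rep (cell (z t))).
  by under eq_fun do rewrite repE; exact: bmf_sum.
have Erep : Ex P (fun t => rep (cell (z t))) = \sum_j cell_prob j * rep j.
  under eq_fun do rewrite repE.
  rewrite Ex_sum//; apply: eq_bigr => j _.
  under eq_fun do rewrite mulrC.
  by rewrite ExZ ?Ex_bool 1?mulrC//; exact: bmf_bool.
have mrep : l%:R^-1 * \sum_(k < l) rep (cell (tnth s k)) = \sum_j cell_freq s j * rep j.
  under eq_bigr do rewrite repE.
  rewrite exchange_big mulr_sumr; apply: eq_bigr => j _.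
  by rewrite /cell_freq -mulrA mulr_suml.
have d1 : `|Ex P (fun t => h (z t)) - \sum_j cell_prob j * rep j| <= e.
  rewrite -Erep -ExB// ler_norml; apply/andP; split.
    rewrite -[leLHS](Ex_cst P); apply: Ex_le => [||t]; [exact: bmf_cst|exact: bmfB|].
    by have := hz t; rewrite ler_norml => /andP[].
  rewrite -[leRHS](Ex_cst P); apply: Ex_le => [||t]; [exact: bmfB|exact: bmf_cst|].
  by have := hz t; rewrite ler_norml => /andP[].
have d2 : `|\sum_j cell_freq s j * rep j - l%:R^-1 * \sum_(k < l) h (tnth s k)| <= e.
  rewrite -mrep -mulrBr normrM ger0_norm ?invr_ge0 ?ler0n// mulrC ler_pdivrMr//.
  rewrite -sumrB (le_trans (ler_norm_sum _ _ _))// mulr_natr -[X in _ *+ X]card_ord.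
  by rewrite -sumr_const; apply: ler_sum => k _; rewrite distrC.
have d3 : `|\sum_j cell_prob j * rep j - \sum_j cell_freq s j * rep j| <=
    M * \sum_j `|cell_freq s j - cell_prob j|.
  rewrite -sumrB mulr_sumr (le_trans (ler_norm_sum _ _ _))//.
  apply: ler_sum => j _; rewrite -mulrBl normrM distrC mulrC.
  by rewrite ler_wpM2r.
rewrite mulr2n mulrDl mul1r -addrA.
apply: le_trans (ler_distD (\sum_j cell_prob j * rep j) _ _) _; rewrite lerD//.
rewrite addrC; apply: le_trans (ler_distD (\sum_j cell_freq s j * rep j) _ _) _.
exact: lerD.
Qed.

End discretization.

Lemma continuous_dist_to (R : realType) (U : topologicalType) (H : normedModType R)
    (phi : U -> H) (w : H) : continuous phi -> continuous (fun u => `|phi u - w|).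
Proof. by move=> cphi u; apply: cvg_norm; apply: cvgB; [exact: cphi|exact: cvg_cst]. Qed.

(** The squared distance of phi(u) and phi(v) is K(u, u) - 2 K(u, v) + K(v, v). *)
Lemma feature_continuous (R : realType) (U : topologicalType) (H : hilbertType R)
    (K : U -> U -> R) (phi : U -> H) :
  continuous (fun uv : U * U => K uv.1 uv.2) ->
  (forall u v, K u v = inner H (phi u) (phi v)) -> continuous phi.
Proof.
move=> cK KE u; apply/cvgrPdist_lt => e e0.
have e20 : 0 < e ^+ 2 by rewrite exprn_gt0.
have dE v : `|phi u - phi v| ^+ 2 = K u u - 2 * K u v + K v v.
  rewrite innerE innerBr !innerBl -!KE.
  by rewrite (KE v u) innerC -(KE u v); ring.
have c1 : (fun v => K u v) @ u --> K u u.
  apply: (@continuous_comp _ _ _ (fun v => (u, v)) (fun uv => K uv.1 uv.2)); last exact: cK.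
  by apply: cvg_pair => //; exact: cvg_cst.
have c2 : (fun v => K v v) @ u --> K u u.
  apply: (@continuous_comp _ _ _ (fun v => (v, v)) (fun uv => K uv.1 uv.2)); last exact: cK.
  exact: cvg_pair.
near=> v; rewrite -(ltr_pXn2r (n := 2)) ?nnegrE ?(ltW e0)// dE.
have h1 : `|K u u - K u v| < e ^+ 2 / 4.
  by near: v; apply: cvgr_dist_lt => //; rewrite divr_gt0.
have h2 : `|K u u - K v v| < e ^+ 2 / 4.
  by near: v; apply: cvgr_dist_lt => //; rewrite divr_gt0.
by move: h1 h2; rewrite !ltr_norml => /andP[? ?] /andP[? ?]; lra.
Unshelve. all: by end_near. Qed.

(** * Risk of the machine trained with a fixed kernel *)

Section consistency.
Context {R : realType} {E : hilbertType R} (Psi : nat -> E)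
  {dsp : measure_display} {T : measurableType dsp} (P : probability T R)
  (X : {RV P >-> borel E}) (Y : {RV P >-> bool}) (Z : option nat -> T -> labeled E).
Hypotheses (mZ : forall i, measurable_fun [set: T] (Z i))
  (idZ : forall i j, identically_distributed P (Z i) (Z j))
  (indZ : mutually_independent P Z) (ZN : forall t, Z None t = (X t, Y t)).
Context (eta : E -> R) (heta : cond_prob1 X Y eta).
Context {d : nat} (Om : set 'rV[R]_d) (cOm : compact Om)
  (XOm : forall t, Om (proj_coords Psi d (X t)))
  {H : hilbertType R} (phi : 'rV[R]_d -> H) (cphi : continuous phi).

Let fx (x : E) : H := phi (proj_coords Psi d x).

Let fx_continuous : continuous fx.
Proof.
move=> x; apply: (@continuous_comp _ _ _ (proj_coords Psi d : E -> 'rV[R]_d) phi).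
  exact: proj_coords_continuous.
exact: cphi.
Qed.

Lemma finite_centers (e : R) : 0 < e -> exists cs : seq 'rV[R]_d,
  (forall c, c \in cs -> Om c) /\
  (forall u, Om u -> has (fun c => `|phi u - phi c| < e) cs).
Proof.
move=> e0; have := cOm; rewrite compact_cover => cov.
have [|u Omu|D DOm Dcov] := cov 'rV[R]_d Om (fun c => [set u | `|phi u - phi c| < e]).
- move=> c _; apply: (open_comp (f := fun u => `|phi u - phi c|) (D := [set x | x < e])).
    by move=> u _; exact: continuous_dist_to.
  exact: open_lt.
- by exists u => //=; rewrite subrr normr0.
exists (enum_fset D); split => [c /DOm /set_mem//|u /Dcov[c Dc uc]].
by apply/hasP; exists c.
Qed.

Lemma feature_bound : exists2 k : R, 0 <= k & forall u, Om u -> `|phi u| <= k.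
Proof.
have [cs [_ csP]] := finite_centers ltr01.
exists (1 + \sum_(c <- cs) `|phi c|); first by rewrite addr_ge0// sumr_ge0.
move=> u /csP/hasP[c ccs uc]; rewrite (big_rem _ ccs)/= addrA.
rewrite -[X in `|X|](subrK (phi c)) (le_trans (ler_normD _ _))//.
apply: (@le_trans _ _ (1 + `|phi c|)); first by rewrite lerD2r ltW.
by rewrite lerDl sumr_ge0.
Qed.

Section cells.
Variables (cs : seq 'rV[R]_d) (dl : R).

(** [find] returns [size cs] when no centre is near, hence the extra index in [cell_of]. Taking the
    first near centre makes the cells disjoint. *)
Definition center_index (x : E) : nat := find (fun c => `|fx x - phi c| < dl) cs.

Definition cell_of (z : labeled E) : 'I_(size cs).+1 * bool := (inord (center_index z.1), z.2).

Lemma center_index_le x : (center_index x <= size cs)%N. Proof. exact: find_size. Qed.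

Lemma measurable_near_center c : measurable_fun [set: borel E]
  (fun x : borel E => `|fx x - phi c| < dl).
Proof.
apply: measurable_fun_ltr; last exact: measurable_cst.
by apply: measurable_borel_continuous; apply: continuous_dist_to; exact: fx_continuous.
Qed.

Lemma measurable_center_index i : measurable_fun [set: borel E]
  (fun x : borel E => center_index x == i).
Proof.
rewrite /center_index; elim: (cs) i => [|c s IH] i /=; first exact: measurable_cst.
rewrite (_ : (fun _ => _) = fun x : borel E =>
    if `|fx x - phi c| < dl then 0%N == i else (find (fun c => `|fx x - phi c| < dl) s).+1 == i).
  apply: measurable_fun_ifT; [exact: measurable_near_center|exact: measurable_cst|].
  case: i => [|i]; last exact: IH.
  by rewrite (_ : (fun _ => _) = fun=> false)//; exact: measurable_cst.
by apply/funext => x; case: ifP.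
Qed.

Lemma measurable_cell j : measurable_fun [set: labeled E] (fun z => cell_of z == j).
Proof.
case: j => i y; rewrite (_ : (fun _ => _) = fun z : labeled E =>
    (center_index z.1 == i) && (z.2 == y)); last first.
  apply/funext => z; rewrite xpair_eqE -val_eqE /= inordK// ltnS; exact: center_index_le.
apply: measurable_and.
  apply: (@measurableT_comp _ _ _ _ _ _ (fun x : borel E => center_index x == i)) => //.
  exact: measurable_center_index.
by apply: (measurable_bool2 eq_op); [exact: measurable_snd|exact: measurable_cst].
Qed.

(** X is in the bounded set for every outcome, but a training input only shares its law: being
    uncovered is impossible for X and merely a null event for the sample. *)
Definition uncovered (z : labeled E) : bool := center_index z.1 == size cs.

Lemma measurable_uncovered : measurable_fun [set: labeled E] uncovered.
Proof.
apply: (@measurableT_comp _ _ _ _ _ _ (fun x : borel E => center_index x == size cs)) => //.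
exact: measurable_center_index.
Qed.

Lemma covered_near z : ~~ uncovered z ->
  center_index z.1 = val (cell_of z).1 /\
  (center_index z.1 < size cs)%N /\ `|fx z.1 - phi (nth 0 cs (center_index z.1))| < dl.
Proof.
rewrite /uncovered neq_ltn => /orP[lt_s|]; last by rewrite ltnNge center_index_le.
split; first by rewrite /= inordK// ltnS center_index_le.
by split => //; apply: (nth_find 0 (a := fun c => `|fx z.1 - phi c| < dl)); rewrite has_find.
Qed.

End cells.

Lemma norm_label_value y : `|label_value R y| = 1.
Proof. by case: y; rewrite /label_value ?normrN normr1. Qed.

Lemma norm_hinge_le (u : R) : `|hinge u| <= 1 + `|u|.
Proof.
have := hinge_lip u 0; have h0 : hinge (0 : R) = 1 by rewrite /hinge subr0 max_r.
rewrite h0 subr0 => h; rewrite -[X in `|X|](subrK 1) addrC.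
by rewrite (le_trans (ler_normD _ _))// normr1 lerD2l.
Qed.

Definition affine_hinge (w : H) (b : R) (z : labeled E) : R :=
  hinge (label_value R z.2 * (inner H w (fx z.1) + b)).

Lemma affine_continuous (w : H) (b : R) : continuous (fun x : E => inner H w (fx x) + b).
Proof.
move=> x; apply: cvgD; last exact: cvg_cst.
rewrite (_ : (fun _ => _) = (fun v => inner H v w) \o fx); last first.
  by apply/funext => z; rewrite /= innerC.
rewrite innerC; apply: (@continuous_comp _ _ _ fx (fun v => inner H v w)).
  exact: fx_continuous.
exact: inner_continuous.
Qed.

Section pointwise.
Variables (r k dl : R) (cs : seq 'rV[R]_d) (l : nat) (s : l.-tuple (labeled E)).
Hypotheses (r0 : 0 < r) (k0 : 0 <= k) (phik : forall u, Om u -> `|phi u| <= k)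
  (dl1 : dl <= 1) (csOm : forall c, c \in cs -> Om c)
  (csP : forall u, Om u -> has (fun c => `|phi u - phi c| < dl) cs)
  (l0 : (0 < l)%N) (sP : forall i, ~~ uncovered cs dl (tnth s i)).

(** At covered points the linear part is at most r (k + 1), as centres have features of norm at most
    k and dl <= 1. The added 2 leaves room for the margins asked by [hinge_clip] and
    [sign_label_clip]; [M] then bounds the hinge losses. *)
Let kk : R := r * (k + 1) + 2.
Let M : R := 1 + (r * (k + 1) + kk).
Let Delta : R := \sum_j `|cell_freq (cell_of cs dl) s j - cell_prob P (cell_of cs dl) (Z None) j|.

Let rk0 : 0 <= r * (k + 1). Proof. by rewrite mulr_ge0 ?addr_ge0// ltW. Qed.
Let kk0 : 0 < kk. Proof. by rewrite /kk; have := rk0; lra. Qed.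

Let covX t : ~~ uncovered cs dl (Z None t).
Proof. by rewrite ZN /uncovered /= neq_ltn /center_index -has_find csP. Qed.

Let covered_norm z : ~~ uncovered cs dl z -> `|fx z.1| <= k + 1.
Proof.
move=> /covered_near[_ [lt_s near]].
rewrite -[fx z.1](subrK (phi (nth 0 cs (center_index cs dl z.1)))).
rewrite (le_trans (ler_normD _ _))// addrC lerD//; last by rewrite (le_trans (ltW near)).
by apply: phik; apply: csOm; exact: mem_nth.
Qed.

Let inner_bound w z : `|w| <= r -> ~~ uncovered cs dl z -> `|inner H w (fx z.1)| <= r * (k + 1).
Proof.
move=> wr /covered_norm zk; rewrite (le_trans (cauchy_schwarz _ _))//.
by rewrite ler_pM.
Qed.

Let bmf_hinge w b : `|w| <= r -> bmf (fun t => affine_hinge w b (Z None t)).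
Proof.
move=> wr; split.
  under eq_fun do rewrite ZN.
  apply: measurable_hinge; apply: measurable_funM.
    by rewrite /label_value; apply: measurable_fun_ifT.
  apply: (@measurableT_comp _ _ _ _ _ _ (fun x : borel E => inner H w (fx x) + b)) => //.
  by apply: measurable_borel_continuous; exact: affine_continuous.
exists (1 + (r * (k + 1) + `|b|)) => t.
rewrite (le_trans (norm_hinge_le _))// lerD2l normrM norm_label_value mul1r.
by rewrite (le_trans (ler_normD _ _))// lerD2r inner_bound.
Qed.

Let affine_hinge_close w b : `|w| <= r -> `|b| <= kk ->
  `|Ex P (fun t => affine_hinge w b (Z None t)) -
    hinge_mean (fun i => fx (tnth s i).1) (fun i => (tnth s i).2) w b| <=
  2 * (r * dl) + M * Delta.
Proof.
move=> wr bk.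
pose rep (j : 'I_(size cs).+1 * bool) : R :=
  if (j.1 < size cs)%N then hinge (label_value R j.2 * (inner H w (phi (nth 0 cs j.1)) + b)) else 0.
have close z : ~~ uncovered cs dl z -> `|affine_hinge w b z - rep (cell_of cs dl z)| <= r * dl.
  move=> /covered_near[idxE [lt_s near]]; rewrite /rep -idxE lt_s.
  rewrite (le_trans (hinge_lip _ _))// -mulrBr normrM norm_label_value mul1r.
  rewrite opprD addrACA subrr addr0 -innerBr (le_trans (cauchy_schwarz _ _))//.
  by rewrite ler_pM// ltW.
apply: (@empirical_mean_close _ _ _ P _ _ (cell_of cs dl) (Z None) _
  (affine_hinge w b) rep M) => //.
- by move=> j; apply: (@measurableT_comp _ _ _ _ _ _ (fun z => cell_of cs dl z == j)) => //;
    exact: measurable_cell.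
- by rewrite /M; have := rk0; have := kk0; lra.
- move=> [i y]; rewrite /rep /=; case: ifP => lt_s; last first.
    by rewrite normr0 /M; have := rk0; have := kk0; lra.
  rewrite (le_trans (norm_hinge_le _))// lerD2l normrM norm_label_value mul1r.
  rewrite (le_trans (ler_normD _ _))// lerD// (le_trans (cauchy_schwarz _ _))//.
  rewrite ler_pM// (le_trans (phik _)) ?lerDl//.
  by apply: csOm; exact: mem_nth.
- exact: bmf_hinge.
- by move=> t; exact: close.
- by move=> i; exact: close.
Qed.

(** Optimality compares empirical hinge risks, so the uniform deviation bound is used twice, for the
    clipped solution and for w0: hence 4 r dl and 2 M Delta. *)
Lemma svm_risk_pointwise (s0 : bool) (w0 : H) (wb : H * R) : `|w0| <= r ->
  svm_solution (r ^+ 2 / l%:R) (fun i => fx (tnth s i).1) (fun i => (tnth s i).2) wb ->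
  Pr P (fun t => svm_classifier Psi s0 phi wb (X t) != Y t) +
  Pr P (fun t => bayes_classifier eta (X t) != Y t) <=
  Ex P (fun t => affine_hinge w0 0 (Z None t)) +
  (`|w0| ^+ 2 / r ^+ 2 + (4 * (r * dl) + 2 * (M * Delta))).
Proof.
move=> w0r sol; have wr := svm_norm_le l0 r0 sol.
set w := wb.1 in wr *; set b := clip kk wb.2.
have bk : `|b| <= kk by apply: clip_norm; exact: ltW.
have c1 := affine_hinge_close wr bk.
have c0 : `|(0 : R)| <= kk by rewrite normr0 ltW.
have := affine_hinge_close w0r c0.
have := @svm_clip_hinge_mean_le _ _ _ _ _ _ l0 r0 _ sol w0 kk.
have -> : (fun t => svm_classifier Psi s0 phi wb (X t) != Y t) =
    (fun t => sign_label s0 (inner H w (fx (X t)) + b) != Y t).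
  apply/funext => t; congr (_ != _); rewrite /svm_classifier sign_label_clip//.
  have := inner_bound wr (covX t); rewrite ZN /= => h; apply: le_lt_trans h _.
  by rewrite /kk ltrDl.
have gm : measurable_fun [set: borel E] (fun x : borel E => inner H w (fx x) + b).
  by apply: measurable_borel_continuous; exact: affine_continuous.
have bg : bmf (fun t => inner H w (fx (X t)) + b).
  split; first exact: (measurableT_comp gm).
  exists (r * (k + 1) + kk) => t; rewrite (le_trans (ler_normD _ _))// lerD//.
  by have := inner_bound wr (covX t); rewrite ZN.
have := zhang heta s0 gm bg.
have -> : (fun t => hinge (label_value R (Y t) * (inner H w (fx (X t)) + b))) =
    (fun t => affine_hinge w b (Z None t)) by apply/funext => t; rewrite ZN.
move=> zh cl; move: c1; rewrite !ler_norml => /andP[_ c1] /andP[c2 _].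
have {}cl := cl _.
apply: le_trans zh _.
have : hinge_mean (fun i => fx (tnth s i).1) (fun i => (tnth s i).2) w b <=
    `|w0| ^+ 2 / r ^+ 2 + hinge_mean (fun i => fx (tnth s i).1) (fun i => (tnth s i).2) w0 0.
  apply: cl => i; have := inner_bound wr (sP i).
  by rewrite /kk; move: (r * _) => a ?; lra.
move: c1 c2; move: (hinge_mean _ _ _ _) (hinge_mean _ _ _ _) => h1 h2.
move: (Ex P _) (Ex P _) (`|w0| ^+ 2 / _) (r * dl) (M * Delta) => *; lra.
Qed.

End pointwise.

(** r is chosen before l, so the number of cells stays fixed while l grows and r^2 / l becomes an
    admissible regularization constant. *)
Lemma svm_risk_bound (s0 : bool) (w0 : H) (e : R) : 0 < e ->
  exists2 r : R, 0 < r & exists L : nat, forall l, (L <= l)%N ->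
  forall (sol : l.-tuple (labeled E) -> H * R) (f : l.-tuple (labeled E) -> E -> bool),
  (forall s, svm_solution (r ^+ 2 / l%:R) (fun i => fx (tnth s i).1)
     (fun i => (tnth s i).2) (sol s)) ->
  (forall s, f s = svm_classifier Psi s0 phi (sol s)) ->
  measurable_fun [set: l.-tuple (labeled E) * borel E] (fun p => f p.1 p.2) ->
  Pr P (fun t => f (sample Z (fun i : 'I_l => Some (val i)) t) (X t) != Y t) +
  Pr P (fun t => bayes_classifier eta (X t) != Y t) <=
  Ex P (fun t => affine_hinge w0 0 (Z None t)) + e.
Proof.
move=> e0; have [k k0 phik] := feature_bound.
(* Large enough for |w0| <= r and |w0|^2 / r^2 <= e / 8. *)
pose r := (`|w0| + 1) * (1 + 8 / e); exists r.
  by apply: mulr_gt0; [exact: ltr_wpDl|apply: addr_gt0 => //; exact: divr_gt0].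
have e8 : 0 < 8 / e by rewrite divr_gt0.
have w01 : 0 <= `|w0| by [].
have w0r : `|w0| <= r by rewrite /r; nra.
have r0 : 0 < r by rewrite /r; nra.
have w0r2 : `|w0| ^+ 2 / r ^+ 2 <= e / 8.
  rewrite ler_pdivrMr ?exprn_gt0// /r.
  have -> : e / 8 * ((`|w0| + 1) * (1 + 8 / e)) ^+ 2 =
      (`|w0| + 1) ^+ 2 * (e / 8 + 2 + 8 / e) by field; rewrite gt_eqF.
  apply: (@le_trans _ _ ((`|w0| + 1) ^+ 2)); first by rewrite ler_pXn2r ?nnegrE ?lerDl ?addr_ge0.
  have e'8 : 0 < e / 8 by rewrite divr_gt0.
  by rewrite ler_peMr ?sqr_ge0//; lra.
(* Gives both dl <= 1 and 4 r dl <= e / 4. *)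
pose dl := e / (16 * r + e).
have d0 : 0 < 16 * r + e by lra.
have dl0 : 0 < dl by rewrite divr_gt0.
have dl1 : dl <= 1 by rewrite /dl ler_pdivrMr//; lra.
have rdl : 4 * (r * dl) <= e / 4.
  rewrite (_ : 4 * (r * dl) = 4 * r * e / (16 * r + e)); last by rewrite /dl; ring.
  by rewrite ler_pdivrMr//; nra.
have [cs [csOm csP]] := finite_centers dl0.
pose M : R := 1 + (r * (k + 1) + (r * (k + 1) + 2)).
have M0 : 0 < M by rewrite /M; nra.
pose J := ('I_(size cs).+1 * bool)%type.
pose nJ : R := #|{: J}|%:R.
have nJ0 : 0 < nJ.
  by rewrite ltr0n; apply/card_gt0P; exists (ord0, true).
(* In 2 M times the mean cell deviation, e2 contributes e / 8, and the lower bound on l below makes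
   the variance term at most e / 8. *)
pose e2 := e / (16 * M * nJ).
have e20 : 0 < e2 by rewrite divr_gt0// !mulr_gt0.
exists (Num.truncn (4 * M * nJ / (e2 * e))).+1 => l Ll sol f solP fE mf.
have l0 : (0 < l)%N by exact: leq_trans Ll.
have lR : 4 * M * nJ / (e2 * e) <= l%:R.
  by rewrite (le_trans (ltW (truncnS_gt _)))// ler_nat.
pose idx (i : 'I_l) := Some (val i).
have inj : injective idx by move=> i j [] /val_inj.
have mG : measurable_fun [set: l.-tuple (labeled E) * labeled E] (fun p => f p.1 p.2.1 != p.2.2).
  apply: (measurable_bool2 (fun a b => a != b)).
    have mp : measurable_fun [set: l.-tuple (labeled E) * labeled E]
        (fun p => (p.1, p.2.1) : l.-tuple (labeled E) * borel E).
      by apply: measurable_fun_pair; [exact: measurable_fst|exact: measurableT_comp].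
    exact: (measurableT_comp mf mp).
  exact: measurableT_comp.
have [bF FE] := Pr_sample mZ idZ indZ (G := fun s z => f s z.1 != z.2) inj
  (fun=> isT : Some _ != None) mG.
have zE (A : E -> bool) : (fun t => A (Z None t).1 != (Z None t).2) = (fun t => A (X t) != Y t).
  by apply/funext => t; rewrite ZN.
pose s t := sample Z idx t.
have -> : (fun t => f (sample Z (fun i : 'I_l => Some (val i)) t) (X t) != Y t) =
    (fun t => f (s t) (Z None t).1 != (Z None t).2) by apply/funext => t; rewrite ZN.
rewrite FE; set Ls := Pr P _; set R0 := Ex P (fun t => affine_hinge _ _ _).
pose D t := \sum_j `|cell_freq (cell_of cs dl) (s t) j - cell_prob P (cell_of cs dl) (Z None) j|.
pose U t : R := \sum_(i < l) (uncovered cs dl (Z (idx i) t))%:R.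
have bfreq j : bmf (fun t => `|cell_freq (cell_of cs dl) (s t) j -
    cell_prob P (cell_of cs dl) (Z None) j|).
  apply: bmf_norm; apply: bmfB; last exact: bmf_cst.
  apply: bmfZ; apply: bmf_sum => i; apply: bmf_bool.
  under eq_fun do rewrite tnth_sample.
  apply: (@measurableT_comp _ _ _ _ _ _ (fun z => cell_of cs dl z == j)) => //.
  exact: measurable_cell.
have bU i : bmf (fun t => (uncovered cs dl (Z i t))%:R : R).
  by apply: bmf_bool; apply: measurableT_comp => //; exact: measurable_uncovered.
have bUs : bmf U by exact: bmf_sum.
have bD : bmf D by exact: bmf_sum.
have U0 t : 0 <= U t by exact: sumr_ge0.
have D0 t : 0 <= D t by exact: sumr_ge0.
have Ls1 : Ls <= 1.
  apply: Pr_le1; apply: (measurable_bool2 (fun a b => a != b)) => //.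
  exact: (measurable_classif X (measurable_bayes heta)).
have R00 : 0 <= R0 by apply: Ex_ge0 => t; rewrite /affine_hinge hinge_ge0.
(* When some training point is uncovered both probabilities are merely at most 1, and 2 U pays for
   them; U has expectation 0. *)
have ptw t : Pr P (fun t' => f (s t) (Z None t').1 != (Z None t').2) + Ls <=
    R0 + (e / 8 + (e / 4 + 2 * (M * D t))) + 2 * U t.
  have [cov|] := boolP [forall i, ~~ uncovered cs dl (tnth (s t) i)].
    have := svm_risk_pointwise r0 k0 phik dl1 csOm csP l0 (forallP cov) s0 w0r (solP (s t)).
    rewrite /= -fE -(zE (f (s t))) -/Ls -/R0 -/(D t) -/M => h.
    by have := U0 t; move: h w0r2 rdl; move: (M * D t) (`|w0| ^+ 2 / _) (r * dl) => *; lra.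
  rewrite negb_forall => /existsP[i]; rewrite negbK tnth_sample => unc.
  have : 1 <= U t.
    rewrite /U (bigD1 i)//= unc lerDl; exact: sumr_ge0.
  have : Pr P (fun t' => f (s t) (Z None t').1 != (Z None t').2) <= 1.
    apply: Pr_le1.
    apply: (@measurableT_comp _ _ _ _ _ _ (fun z : labeled E => f (s t) z.1 != z.2)) => //.
    exact: (measurableT_comp mG (measurable_pair1 _)).
  have : 0 <= M * D t by rewrite mulr_ge0// ltW.
  by move: (M * D t) (Pr P _) => *; lra.
have EU : Ex P U = 0.
  rewrite /U Ex_sum// big1// => i _.
  rewrite Ex_bool; last by apply: measurableT_comp => //; exact: measurable_uncovered.
  rewrite (Pr_id idZ (measurable_uncovered _ _) _ None).
  rewrite (_ : (fun t => _) = fun=> false); first by rewrite -Ex_bool// Ex_cst.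
  apply/funext => t; rewrite ZN /uncovered /=; apply/negbTE.
  by rewrite neq_ltn /center_index -has_find csP.
have ED : Ex P D <= nJ * (e2 + (4 * e2 * l%:R)^-1).
  rewrite /D Ex_sum// /nJ mulr_natl -sumr_const; apply: ler_sum => j _.
  apply: le_trans
    (lln_event mZ idZ indZ (b := fun z => cell_of cs dl z == j) _ None l0 inj e20); last first.
    exact: measurable_cell.
  rewrite le_eqVlt; apply/orP; left; apply/eqP; congr Ex; apply/funext => t.
  by congr `|_ * _ - _|; apply: eq_bigr => i _; rewrite tnth_sample.
have bt : bmf (fun t => R0 + (e / 8 + (e / 4 + 2 * (M * D t))) + 2 * U t).
  do ?[exact: bmf_cst|exact: bmfZ|apply: bmfD|apply: bmfZ].
have := Ex_le P (bmfD bF (bmf_cst Ls)) bt ptw.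
rewrite ExD//; last exact: bmf_cst.
rewrite Ex_cst ExD; do ?[exact: bmf_cst|exact: bmfZ|apply: bmfD|apply: bmfZ].
rewrite ExD; do ?[exact: bmf_cst|exact: bmfZ|apply: bmfD|apply: bmfZ].
rewrite ExD; do ?[exact: bmf_cst|exact: bmfZ|apply: bmfD|apply: bmfZ].
rewrite ExD; do ?[exact: bmf_cst|exact: bmfZ|apply: bmfD|apply: bmfZ].
rewrite !Ex_cst !ExZ//; last exact: bmfZ.
rewrite EU mulr0 addr0 => h; apply: le_trans h _; rewrite lerD2l.
have : 2 * (M * Ex P D) <= e / 8 + e / 8.
  apply: (@le_trans _ _ (2 * (M * (nJ * (e2 + (4 * e2 * l%:R)^-1))))).
    by rewrite ler_pM2l// ler_pM2l.
  have lR0 : 0 < l%:R :> R by rewrite ltr0n.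
  rewrite (_ : 2 * _ = 2 * M * nJ * e2 + (M * nJ / e2) / 2 / l%:R); last first.
    by field; rewrite !gt_eqF.
  rewrite lerD//; first by rewrite /e2 le_eqVlt; apply/orP; left; apply/eqP; field; rewrite !gt_eqF.
  rewrite ler_pdivrMr//; apply: (@le_trans _ _ (e / 8 * (4 * M * nJ / (e2 * e)))).
    by rewrite le_eqVlt; apply/orP; left; apply/eqP; field; rewrite !gt_eqF.
  by rewrite ler_pM2l// divr_gt0.
move: (2 * _) => a ?; lra.
Qed.

End consistency.

(** * Model selection *)

Section model_selection.
Context {d : measure_display} {T : measurableType d} {R : realType}
  (P : probability T R) {d' : measure_display} {S : measurableType d'}
  (Z : option nat -> T -> S).
Hypotheses (mZ : forall i, measurable_fun [set: T] (Z i))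
  (idZ : forall i j, identically_distributed P (Z i) (Z j))
  (indZ : mutually_independent P Z).
Variables (l m k : nat) (m0 : (0 < m)%N) (k0 : (0 < k)%N).
Variables (A : Type) (M : eqType) (mdl : A -> M) (Lam : M -> R)
  (adm : A -> Prop) (err : A -> l.-tuple S -> S -> bool)
  (astar : l.-tuple S -> m.-tuple S -> A) (a0 : A) (Sn : nat) (W : R).
Hypotheses (mstar : measurable_fun [set: l.-tuple S * m.-tuple S * S]
    (fun p => err (astar p.1.1 p.1.2) p.1.1 p.2))
  (merr0 : measurable_fun [set: l.-tuple S * S] (fun p => err a0 p.1 p.2))
  (adm_star : forall s v, adm (astar s v)).
Hypothesis selP : forall s (v : m.-tuple S),
  m%:R^-1 * \sum_(i < m) (err (astar s v) s (tnth v i))%:R + Lam (mdl (astar s v)) <=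
  m%:R^-1 * \sum_(i < m) (err a0 s (tnth v i))%:R + Lam (mdl a0).
Hypothesis patP : forall s (w : 'I_m * 'I_k -> S) (mu : M),
  exists2 L : seq {ffun 'I_m * 'I_k -> bool}, (size L <= Sn)%N &
    forall a, adm a -> mdl a = mu -> [ffun p => err a s (w p)] \in L.
(** The list of models selected over all choices varies with the outcome; W has to be the same for
    all such lists. *)
Hypothesis sumP : forall mus : seq M, (forall mu, mu \in mus -> exists2 a, adm a & mdl a = mu) ->
  exists ms : seq M, [/\ {subset mus <= ms}, (forall mu, mu \in ms -> 0 <= Lam mu) &
    \sum_(mu <- ms) expR (- 2 * m%:R * Lam mu ^+ 2) <= W].

(* The pool is an m x k array of independent draws whose first column is the
   validation set; each choice c of one draw per row is again a validation set. *)
Definition pool_index (p : 'I_m * 'I_k) : nat :=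
  (l + (if p.2 == 0 :> nat then p.1 : nat else m + (p.1 * k + p.2)))%N.

Lemma pool_index_inj : injective pool_index.
Proof.
move=> [i j] [i' j']; rewrite /pool_index /= => /addnI.
case: ifP => [/eqP j0|jn0]; case: ifP => [/eqP j'0|j'n0].
- by move=> /val_inj ->; congr pair; apply: val_inj; rewrite /= j0 j'0.
- by move=> ii; have := ltn_ord i; rewrite ii ltnNge leq_addr.
- by move=> ii; have := ltn_ord i'; rewrite -ii ltnNge leq_addr.
move=> /addnI eq_ij.
have ij (x : 'I_m) (y : 'I_k) : ((x * k + y) %/ k = x)%N.
  by rewrite divnMDl// divn_small ?addn0.
have ii : i = i' by apply: val_inj; rewrite /= -[LHS](ij _ j) eq_ij ij.
by move: eq_ij; rewrite ii => /addnI /val_inj ->.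
Qed.

Lemma pool_index_ge p : (l <= pool_index p)%N. Proof. exact: leq_addr. Qed.

Let train (t : T) : l.-tuple S := sample Z (fun i : 'I_l => Some (val i)) t.

Let chosen (c : {ffun 'I_m -> 'I_k}) (t : T) : m.-tuple S :=
  sample Z (fun i : 'I_m => Some (pool_index (i, c i))) t.

Let valid (t : T) : m.-tuple S := sample Z (fun i : 'I_m => Some (l + i)%N) t.

Let risk_star : R := Pr P (fun t => err (astar (train t) (valid t)) (train t) (Z None t)).

Let risk0 : R := Pr P (fun t => err a0 (train t) (Z None t)).

(** An entry that was not drawn is a fresh test point for the classifier selected with the
    validation set c. *)
Let Pr_chosen (c : {ffun 'I_m -> 'I_k}) i j : j != c i ->
  Pr P (fun t => err (astar (train t) (chosen c t)) (train t) (Z (Some (pool_index (i, j))) t)) =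
  risk_star.
Proof.
move=> jci.
pose idx (q : option ('I_l + 'I_m)) : option nat :=
  match q with
  | None => Some (pool_index (i, j))
  | Some (inl q) => Some (val q)
  | Some (inr q) => Some (pool_index (q, c q))
  end.
pose idx' (q : option ('I_l + 'I_m)) : option nat :=
  match q with
  | None => None
  | Some (inl q) => Some (val q)
  | Some (inr q) => Some (l + q)%N
  end.
have ne (q : 'I_l) p : val q <> pool_index p.
  by move=> qp; have := pool_index_ge p; rewrite -qp leqNgt ltn_ord.
have inj : injective idx.
  move=> [[q|q]|] [[q'|q']|] //= [].
  - by move=> /val_inj ->.
  - by move=> /ne.
  - by move=> /ne.
  - by move=> /esym/ne.
  - by move=> /pool_index_inj [->].
  - by move=> /pool_index_inj [qi cqj]; rewrite -cqj qi eqxx in jci.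
  - by move=> /esym/ne.
  - by move=> /pool_index_inj [qi cqj]; rewrite cqj qi eqxx in jci.
have inj' : injective idx'.
  move=> [[q|q]|] [[q'|q']|] //= [].
  - by move=> /val_inj ->.
  - by move=> qE; have := ltn_ord q; rewrite /= qE ltnNge leq_addr.
  - by move=> qE; have := ltn_ord q'; rewrite /= -qE ltnNge leq_addr.
  - by move=> /addnI /val_inj ->.
exact: (exchangeable_blocks mZ idZ indZ inj inj' mstar).
Qed.

Let Pr_risk0 p :
  Pr P (fun t => err a0 (train t) (Z (Some (pool_index p)) t)) = risk0.
Proof.
(* The parameter [a0] is fixed and ignores the validation data, so the second block is empty. *)
pose idx o (q : option ('I_l + 'I_0)) : option nat :=
  match q with
  | None => o
  | Some (inl q) => Some (val q)
  | Some (inr q) => None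
  end.
have inj o : (forall q : 'I_l, Some (val q) <> o) -> injective (idx o).
  move=> ne [[q|[]]//|] [[q'|[]]//|] //=.
  - by move=> [/val_inj ->].
  - by move=> /ne.
  - by move=> /esym/ne.
pose G (w : l.-tuple S * 0.-tuple S * S) := err a0 w.1.1 w.2.
have mp : measurable_fun [set: l.-tuple S * 0.-tuple S * S]
    (fun w => (w.1.1, w.2) : l.-tuple S * S).
  apply: measurable_fun_pair; last exact: measurable_snd.
  by apply: measurableT_comp; exact: measurable_fst.
have mG : measurable_fun setT G by exact: (measurableT_comp merr0 mp).
apply: (exchangeable_blocks mZ idZ indZ (inj (Some (pool_index p)) _) (inj None _) mG) => //.
by move=> q [qp]; have := pool_index_ge p; rewrite -qp leqNgt ltn_ord.
Qed.

(** [ptw] concerns a fixed outcome, where only c varies. Taking expectations turns the array mean of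
    the selected classifier into at least risk_star - 1/k, and the validation error of [a0] into
    risk0 exactly. *)
Lemma selection_risk (t : R) : 0 <= t ->
  risk_star <= risk0 + Lam (mdl a0) + t + Sn%:R * expR (- 2 * m%:R * t ^+ 2) * W + k%:R^-1.
Proof.
move=> t0.
pose eps := Lam (mdl a0) + t + Sn%:R * expR (- 2 * m%:R * t ^+ 2) * W.
have mR : 0 < m%:R :> R by rewrite ltr0n.
have kR : 0 < k%:R :> R by rewrite ltr0n.
pose w x p := Z (Some (pool_index p)) x.
pose pat a x : {ffun 'I_m * 'I_k -> bool} := [ffun p => err a (train x) (w x p)].
pose as_ c x := astar (train x) (chosen c x).
have ptw x : \sum_(c : {ffun 'I_m -> 'I_k}) pool_mean (pat (as_ c x) x) <=
    \sum_(c : {ffun 'I_m -> 'I_k}) (choice_mean (pat a0 x) c + eps).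
  pose mus := [seq mdl (as_ c x) | c : {ffun 'I_m -> 'I_k}].
  have musP mu : mu \in mus -> exists2 a, adm a & mdl a = mu.
    by move=> /mapP[c _ ->]; exists (as_ c x) => //; exact: adm_star.
  have [ms [sub_ms Lam0 sumW]] := sumP musP.
  have exL mu : exists L : seq {ffun 'I_m * 'I_k -> bool}, (size L <= Sn)%N /\
      forall a, adm a -> mdl a = mu -> [ffun p => err a (train x) (w x p)] \in L.
    by have [L sL LP] := patP (train x) (w x) mu; exists L.
  have [pats patsP] := choice exL.
  have mem1 c : mdl (as_ c x) \in ms by apply: sub_ms; apply: map_f; rewrite mem_enum.
  have mem2 c : pat (as_ c x) x \in pats (mdl (as_ c x)).
    by apply: (proj2 (patsP _)) => //; exact: adm_star.
  have H := selection_count m0 k0 t0 Lam0 (fun mu => proj1 (patsP mu)) mem1 mem2.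
  have {}H : \sum_(c : {ffun 'I_m -> 'I_k}) (pool_mean (pat (as_ c x) x) -
      choice_mean (pat (as_ c x) x) c - Lam (mdl (as_ c x))) <=
      k%:R ^+ m * (t + Sn%:R * expR (- 2 * m%:R * t ^+ 2) * W).
    apply: le_trans H _.
    rewrite ler_wpM2l ?exprn_ge0// lerD2l -mulrA -mulr_sumr ler_wpM2l//.
    apply: le_trans (_ : _ <= expR (- 2 * m%:R * t ^+ 2) *
      \sum_(mu <- ms) expR (- 2 * m%:R * Lam mu ^+ 2)) _; last first.
      by rewrite ler_wpM2l// ltW ?expR_gt0.
    rewrite mulr_sumr big_seq [leRHS]big_seq; apply: ler_sum => mu /Lam0 L0.
    rewrite -expRD ler_expR -mulrDr -subr_ge0.
    (* The dropped cross term of (t + Lam)^2, nonnegative because the penalties are. *)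
    rewrite [leRHS](_ : _ = 2 * m%:R * (2 * (t * Lam mu))); last by ring.
    by rewrite !mulr_ge0.
  have sel c : choice_mean (pat (as_ c x) x) c + Lam (mdl (as_ c x)) <=
      choice_mean (pat a0 x) c + Lam (mdl a0).
    have := selP (train x) (chosen c x); rewrite /choice_mean /as_.
    under eq_bigr do rewrite tnth_sample.
    under [X in _ <= _ * X + _ -> _]eq_bigr do rewrite tnth_sample.
    by under [X in _ -> _ * X + _ <= _]eq_bigr do rewrite ffunE;
       under [X in _ -> _ <= _ * X + _]eq_bigr do rewrite ffunE.
  have cE (C : R) : k%:R ^+ m * C = \sum_(c : {ffun 'I_m -> 'I_k}) C.
    by rewrite sumr_const card_ffun !card_ord -[C *+ _]mulr_natl natrX.
  rewrite cE -subr_ge0 -sumrB in H; rewrite -subr_ge0 -sumrB.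
  apply: le_trans H _; apply: ler_sum => c _; have := sel c; rewrite /eps; lra.
have mtrain : measurable_fun [set: T] train by exact: measurable_sample.
have m1 c p : measurable_fun [set: T] (fun x => err (as_ c x) (train x) (w x p)).
  have mp : measurable_fun [set: T] (fun x => (train x, chosen c x, w x p)).
    apply: measurable_fun_pair; last exact: mZ.
    by apply: measurable_fun_pair => //; exact: measurable_sample.
  exact: (measurableT_comp mstar mp).
have m2 p : measurable_fun [set: T] (fun x => err a0 (train x) (w x p)).
  have mp : measurable_fun [set: T] (fun x => (train x, w x p)).
    by apply: measurable_fun_pair => //; exact: mZ.
  exact: (measurableT_comp merr0 mp).
have b1 c p : bmf (fun x => (err (as_ c x) (train x) (w x p))%:R : R) by exact: bmf_bool.
have b2 p : bmf (fun x => (err a0 (train x) (w x p))%:R : R) by exact: bmf_bool.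
have poolE c x : pool_mean (pat (as_ c x) x) =
    m%:R^-1 * \sum_i (k%:R^-1 * \sum_j (err (as_ c x) (train x) (w x (i, j)))%:R) :> R.
  congr (_ * _); apply: eq_bigr => i _; congr (_ * _); apply: eq_bigr => j _.
  by rewrite ffunE.
have choiceE c x : choice_mean (pat a0 x) c =
    m%:R^-1 * \sum_i (err a0 (train x) (w x (i, c i)))%:R :> R.
  by congr (_ * _); apply: eq_bigr => i _; rewrite ffunE.
have bp c : bmf (fun x => pool_mean (pat (as_ c x) x) : R).
  under eq_fun do rewrite poolE.
  by apply: bmfZ; apply: bmf_sum => i; apply: bmfZ; exact: bmf_sum.
have bc c : bmf (fun x => choice_mean (pat a0 x) c : R).
  by under eq_fun do rewrite choiceE; apply: bmfZ; exact: bmf_sum.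
have mean_cst (C : R) : m%:R^-1 * \sum_(i < m) C = C.
  by rewrite sumr_const card_ord -[C *+ m]mulr_natl mulKf ?gt_eqF.
have Ec c : Ex P (fun x => choice_mean (pat a0 x) c : R) = risk0.
  under eq_fun do rewrite choiceE.
  rewrite ExZ ?Ex_sum//; last exact: bmf_sum.
  under eq_bigr => i _ do rewrite Ex_bool// Pr_risk0.
  exact: mean_cst.
have risk01 : 0 <= risk_star <= 1.
  rewrite Pr_ge0 /risk_star Pr_le1//.
  have mp : measurable_fun [set: T] (fun x => (train x, valid x, Z None x)).
    apply: measurable_fun_pair; last exact: mZ.
    by apply: measurable_fun_pair => //; exact: measurable_sample.
  exact: (measurableT_comp mstar mp).
(* In each row one entry served for the selection and is counted as 0, which costs at most 1/k. *)
have Ep c : risk_star - k%:R^-1 <= Ex P (fun x => pool_mean (pat (as_ c x) x) : R).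
  under eq_fun do rewrite poolE.
  rewrite ExZ; last by apply: bmf_sum => i; apply: bmfZ; exact: bmf_sum.
  rewrite Ex_sum; last by move=> i; apply: bmfZ; exact: bmf_sum.
  rewrite -[leLHS]mean_cst ler_wpM2l ?invr_ge0//; apply: ler_sum => i _.
  rewrite ExZ ?Ex_sum//; last exact: bmf_sum.
  apply: (@le_trans _ _ (k%:R^-1 * \sum_(j < k) (risk_star - (j == c i)%:R))).
    rewrite sumrB sumr_const card_ord -[risk_star *+ k]mulr_natl mulrBr mulKf ?gt_eqF//.
    rewrite lerD2l lerN2 (bigD1 (c i))//= eqxx big1 ?addr0 ?mulr1// => j jc.
    by rewrite (negPf jc).
  rewrite ler_wpM2l ?invr_ge0//; apply: ler_sum => j _; rewrite Ex_bool//.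
  have [->|jc] := eqVneq j (c i); last by rewrite subr0 Pr_chosen.
  apply: le_trans (Pr_ge0 _ _); rewrite subr_le0; by have /andP[] := risk01.
have cE (C : R) : \sum_(c : {ffun 'I_m -> 'I_k}) C = k%:R ^+ m * C.
  by rewrite sumr_const card_ffun !card_ord -[C *+ _]mulr_natl natrX.
have Ece c : Ex P (fun x => choice_mean (pat a0 x) c + eps) = risk0 + eps.
  by rewrite ExD ?Ex_cst ?Ec//; exact: bmf_cst.
have := Ex_le P (bmf_sum _ bp) (bmf_sum _ (fun c => bmfD (bc c) (bmf_cst eps))) ptw.
rewrite (Ex_sum P _ bp) Ex_sum; last by move=> c; apply: bmfD => //; exact: bmf_cst.
rewrite [X in _ <= X -> _](eq_bigr (fun=> risk0 + eps) (fun c _ => Ece c)).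
have : \sum_(c : {ffun 'I_m -> 'I_k}) (risk_star - k%:R^-1) <=
    \sum_(c : {ffun 'I_m -> 'I_k}) Ex P (fun x => pool_mean (pat (as_ c x) x) : R).
  by apply: ler_sum => c _; exact: Ep.
move=> /le_trans H /H; rewrite !cE ler_pM2l ?exprn_gt0//.
by rewrite lerBlDr /eps !addrA.
Qed.

End model_selection.

(** * Consistency of the selected classifier *)

(** Since m k + 1 <= m^2 and 2 (l + 1) <= 4 l, the count is at most exp(4 l ln m) <= exp(t^2 m).
    Half of the exponent is left, and exp(-x) <= 1/x. *)
Lemma pattern_exp_bound (R : realType) (l m k : nat) (t : R) : (0 < l)%N -> (k.+1 <= m)%N ->
  0 < t -> 4 * (l%:R * ln m%:R) <= t ^+ 2 * m%:R ->
  ((m * k).+1 ^ l.+1)%:R * expR (- 2 * m%:R * t ^+ 2) <= (t ^+ 2 * m%:R)^-1.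
Proof.
move=> l0 km t0 rate.
have m0 : (0 < m)%N by exact: leq_trans km.
have mR : 0 < m%:R :> R by rewrite ltr0n.
have x0 : 0 < t ^+ 2 * m%:R by rewrite mulr_gt0// exprn_gt0.
have le_pow : ((m * k).+1 ^ l.+1 <= m ^ (4 * l))%N.
  apply: leq_trans (_ : (m * m) ^ l.+1 <= _)%N.
    rewrite leq_exp2r//; apply: leq_trans (_ : m * k.+1 <= _)%N; last by rewrite leq_mul2l km orbT.
    by rewrite mulnS -addn1 addnC leq_add2r.
  rewrite mulnn -expnM leq_pexp2l//.
  by rewrite mulnS (_ : 4 * l = 2 * l + 2 * l)%N ?leq_add2r ?leq_pmulr//; rewrite -mulnDl.
have mE : (m ^ (4 * l))%:R = expR (4 * (l%:R * ln m%:R)) :> R.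
  by rewrite natrX mulrA -natrM expRM_natl lnK.
apply: le_trans (_ : expR (4 * (l%:R * ln m%:R)) * expR (- 2 * m%:R * t ^+ 2) <= _).
  by rewrite ler_wpM2r ?(ltW (expR_gt0 _))// -mE ler_nat.
rewrite -expRD; apply: le_trans (_ : expR (- (t ^+ 2 * m%:R)) <= _).
  by rewrite ler_expR; lra.
rewrite expRN lef_pV2 ?posrE ?expR_gt0//.
by apply: le_trans (expR_ge1Dx _); rewrite lerDr.
Qed.

Section svm_patterns.
Context {R : realType} {E : hilbertType R} (Psi : nat -> E) (s0 : bool) {d : nat}
  {H : hilbertType R} (phi : 'rV[R]_d -> H).

(** L is fixed before C: every trained function is a combination of l kernel sections and the
    constant 1, whence the exponent l + 1. *)
Lemma svm_pattern_cover (l : nat) (s : l.-tuple (labeled E)) (T : finType) (w : T -> labeled E) :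
  exists2 L : seq {ffun T -> bool}, (size L <= #|T|.+1 ^ l.+1)%N &
  forall C wb, svm_solution C (fun i => phi (proj_coords Psi d (tnth s i).1))
      (fun i => (tnth s i).2) wb ->
    [ffun p => svm_classifier Psi s0 phi wb (w p).1 != (w p).2] \in L.
Proof.
pose F (z : E) := phi (proj_coords Psi d z).
pose h (i : 'I_l.+1) (z : E) : R :=
  if unlift ord0 i is Some j then inner H (F (tnth s j).1) (F z) else 1.
have [L sL LP] := sign_pattern_cover s0 h [seq (w p).1 | p <- enum T].
exists [seq [ffun p => nth false b (index p (enum T)) != (w p).2] | b <- L].
  by rewrite size_map (leq_trans sL)// size_map -cardE.
move=> C wb /svm_solution_in_span[c wE].
pose al (i : 'I_l.+1) : R := if unlift ord0 i is Some j then c j else wb.2.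
apply/mapP.
exists [seq sign_label s0 (\sum_i al i * h i z) | z <- [seq (w p).1 | p <- enum T]] => //.
apply/ffunP => p; rewrite !ffunE; congr (_ != _).
rewrite -map_comp (nth_map p) ?index_mem ?mem_enum// nth_index ?mem_enum//=.
rewrite /svm_classifier; congr sign_label; rewrite big_ord_recl /al /h unlift_none mulr1 addrC.
congr (_ + _); rewrite wE inner_suml; apply: eq_bigr => i _.
by rewrite liftK innerZl.
Qed.

End svm_patterns.

Lemma continuous_rescale (R : realType) (T : topologicalType) (g : T -> R) :
  continuous g -> continuous (fun u => 2 * g u - 1).
Proof.
move=> cg u; apply: cvgB; last exact: cvg_cst.
by apply: cvgM; [exact: cvg_cst|exact: cg].
Qed.

(** * Approaching twice the Bayes error by a hinge risk *)

Section hinge_approximation.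
Context {R : realType} {E : hilbertType R} (Psi : nat -> E) (hPsi : hilbert_basis Psi)
  {dsp : measure_display} {T : measurableType dsp} (P : probability T R)
  (X : {RV P >-> borel E}) (Y : {RV P >-> bool}) (eta : E -> R) (heta : cond_prob1 X Y eta).

Lemma hinge_label_lip (y : bool) (a b : R) :
  hinge (label_value R y * a) <= hinge (label_value R y * b) + `|a - b|.
Proof.
rewrite -lerBlDl; apply: le_trans (ler_norm _) _; apply: le_trans (hinge_lip _ _) _.
by rewrite -mulrBr normrM norm_label_value mul1r.
Qed.

(** The Bayes label, read as 1 or -1, has hinge loss 2 when it errs and 0 otherwise, and the hinge
    is 1-Lipschitz. The dimension comes from the cylinder approximation, hence before the kernel. *)
Lemma hinge_risk_approx (Om : forall d, set 'rV[R]_d) (e : R) : 0 < e ->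
  (forall d t, (1 <= d)%N -> Om d (proj_coords Psi d (X t))) ->
  exists2 d, (1 <= d)%N & forall (K : kernel_fun R d) (H : hilbertType R)
    (phi : 'rV[R]_d -> H), universal_kernel (Om d) K phi -> continuous phi ->
  exists w0 : H, Ex P (fun t => hinge (label_value R (Y t) *
      (inner H w0 (phi (proj_coords Psi d (X t))) + 0))) <=
    2 * Pr P (fun t => bayes_classifier eta (X t) != Y t) + e.
Proof.
move=> e0 XOm; have e4 : 0 < e / 4 by rewrite divr_gt0.
pose A : set (borel E) := [set x | bayes_classifier eta x].
have mA : measurable A by exact: (measurable_event (measurable_bayes heta)).
have [n [g [cg g01 gA]]] := proj2 (cylinder_approx_measurable hPsi X mA) _ e4.
exists n.+1 => // K H phi [_ univ] cphi.
(* 2 g - 1 carries the approximate indicator of the Bayes region to the scale of labels; its error 2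
   (e / 4) and the e / 4 of universality stay below e. *)
have [w0 w0P] := univ (fun u => 2 * g u - 1) (continuous_subspaceT (continuous_rescale cg)) _ e4.
exists w0.
pose D t := `|g (proj_coords Psi n.+1 (X t)) - (X t \in A)%:R|.
have mfX := measurable_classif X (measurable_bayes heta).
have mne : measurable_fun [set: T] (fun t => bayes_classifier eta (X t) != Y t).
  exact: (measurable_bool2 (fun a b => a != b)).
have XA t : (X t \in A) = bayes_classifier eta (X t).
  by apply/idP/idP => [/set_mem|?]; [|exact/mem_set].
have mXA : measurable_fun [set: T] (fun t => X t \in A) by under eq_fun do rewrite XA.
have D1 t : D t <= 1.
  have /andP[] := g01 (proj_coords Psi n.+1 (X t)); rewrite /D ler_norml.
  by case: (X t \in A) => /= ? ?; apply/andP; split; lra.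
have D0 t : 0 <= D t by exact: normr_ge0.
have bD : bmf D.
  split; last by exists 1 => t; rewrite /D normr_id; exact: D1.
  apply: measurableT_comp => //; apply: measurable_funB; last exact: (proj1 (bmf_bool mXA)).
  apply: (@measurableT_comp _ _ _ _ _ _ (fun x : borel E => g (proj_coords Psi n.+1 x))) => //.
  apply: measurable_borel_continuous => x.
  apply: (@continuous_comp _ _ _ (proj_coords Psi n.+1 : E -> _) g); last exact: cg.
  exact: proj_coords_continuous.
have ptw t : hinge (label_value R (Y t) * (inner H w0 (phi (proj_coords Psi n.+1 (X t))) + 0)) <=
    2 * (bayes_classifier eta (X t) != Y t)%:R + (e / 4 + 2 * D t).
  rewrite addr0.
  apply: le_trans (hinge_label_lip _ _ (label_value R (bayes_classifier eta (X t)))) _.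
  apply: lerD.
    rewrite /hinge /label_value; case: (Y t); case: (bayes_classifier _ _) => /=;
    rewrite ?mulrN1 ?mul1r ?opprK ge_max /=; lra.
  apply: le_trans (ler_distD (2 * g (proj_coords Psi n.+1 (X t)) - 1) _ _) _.
  apply: lerD; first by apply: ltW; apply: w0P; exact: XOm.
  have -> : 2 * D t = `|2 * (g (proj_coords Psi n.+1 (X t)) - (X t \in A)%:R)|.
    by rewrite normrM ger0_norm.
  rewrite XA le_eqVlt; apply/orP; left; apply/eqP; congr `|_|.
  by rewrite /label_value; case: (bayes_classifier _ _) => /=; ring.
have bR : bmf (fun t => 2 * (bayes_classifier eta (X t) != Y t)%:R + (e / 4 + 2 * D t)).
  apply: bmfD; first by apply: bmfZ; exact: bmf_bool.
  by apply: bmfD; [exact: bmf_cst|exact: bmfZ].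
have bL : bmf (fun t => hinge (label_value R (Y t) *
    (inner H w0 (phi (proj_coords Psi n.+1 (X t))) + 0))).
  split; last first.
    exists (4 + e / 4) => t; rewrite ger0_norm ?hinge_ge0// (le_trans (ptw t))//.
    by have := D1 t; case: (_ != _) => /=; lra.
  apply: measurable_hinge; apply: measurable_funM.
    by rewrite /label_value; apply: measurable_fun_ifT.
  apply: (@measurableT_comp _ _ _ _ _ _
    (fun x : borel E => inner H w0 (phi (proj_coords Psi n.+1 x)) + 0)) => //.
  by apply: measurable_borel_continuous; exact: affine_continuous.
apply: le_trans (Ex_le P bL bR ptw) _.
rewrite ExD; [|by apply: bmfZ; exact: bmf_bool|by apply: bmfD; [exact: bmf_cst|exact: bmfZ]].
rewrite ExD; [|exact: bmf_cst|exact: bmfZ].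
rewrite Ex_cst !ExZ//; last exact: bmf_bool.
by rewrite Ex_bool// lerD2l; move: gA; rewrite -/D; lra.
Qed.

End hinge_approximation.

(** A dependent pair, as the type of a kernel depends on d. The regularization constant is forgotten
    because it affects neither penalty nor pattern count. *)
Definition model (R : realType) := {d : nat & 'rV[R]_d -> 'rV[R]_d -> R}.

Definition model_of (R : realType) (a : svm_param R) : model R :=
  Tagged (fun d => 'rV[R]_d -> 'rV[R]_d -> R) (par_ker a).

(** The m in the exponent cancels the square of 1 / sqrt m, so W is the sum of the assumed series,
    whatever m. The list is completed to all kernels of bounded dimension to become a partial
    sum. *)
Lemma model_penalty_sum (R : realType) (J : forall d, set (kernel_fun R d)) (lambda : nat -> R) :
  (forall d, (1 <= d)%N -> finite_set (J d)) -> (forall d, (1 <= d)%N -> 0 <= lambda d) ->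
  (\sum_(1 <= d <oo) (#|` fset_set (J d)|%:R * expR (- 2 * lambda d ^+ 2))%:E < +oo)%E ->
  exists2 W : R, 0 <= W & forall (m : nat) (mus : seq (model R)), (0 < m)%N ->
    (forall mu, mu \in mus -> (1 <= tag mu)%N /\ J (tag mu) (tagged mu)) ->
    exists ms : seq (model R), [/\ {subset mus <= ms},
      forall mu, mu \in ms -> 0 <= lambda (tag mu) / Num.sqrt m%:R &
      \sum_(mu <- ms) expR (- 2 * m%:R * (lambda (tag mu) / Num.sqrt m%:R) ^+ 2) <= W].
Proof.
move=> finJ lam0 sumJ.
pose u d : R := #|` fset_set (J d)|%:R * expR (- 2 * lambda d ^+ 2).
have u0 d : 0 <= u d by rewrite mulr_ge0// ltW ?expR_gt0.
have tot0 : (0 <= \sum_(1 <= d <oo) (u d)%:E)%E by apply: nneseries_ge0 => d _ _; rewrite lee_fin.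
exists (fine (\sum_(1 <= d <oo) (u d)%:E)); first exact: fine_ge0.
move=> m mus m0 musP.
pose D := (\max_(mu <- mus) tag mu).+1.
pose ms : seq (model R) := [seq Tagged (fun d => 'rV[R]_d -> 'rV[R]_d -> R) K |
  d <- index_iota 1 D, K <- enum_fset (fset_set (J d))].
exists ms; split.
- move=> mu mumus; have [d1 Jmu] := musP _ mumus.
  case: mu mumus d1 Jmu => d K /= mumus d1 JK.
  apply: (allpairs_f_dep (fun d (K : 'rV[R]_d -> 'rV[R]_d -> R) =>
    Tagged (fun d => 'rV[R]_d -> 'rV[R]_d -> R) K)).
    by rewrite mem_index_iota d1 /= /D ltnS (leq_bigmax_seq (F := tag) _ mumus).
  have := in_fset_set (finJ d d1) K; rewrite /= => ->; exact/mem_set.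
- move=> mu /allpairsPdep[d [K [+ _ ->]]] /=; rewrite mem_index_iota => /andP[d1 _].
  by rewrite divr_ge0 ?lam0// sqrtr_ge0.
rewrite big_allpairs_dep /=.
rewrite (eq_big_seq u) => [|d]; last first.
  move=> _; rewrite /u big_const_seq count_predT iter_addr addr0 mulr_natl; congr (_ *+ _).
  congr expR; rewrite expr_div_n sqr_sqrtr//; field.
  by rewrite pnatr_eq0 -lt0n.
rewrite -lee_fin fineK; last by rewrite ge0_fin_numE.
rewrite -sumEFin; apply: nneseries_lim_ge => d _ _; by rewrite lee_fin.
Qed.

Theorem theorem1 (R : realType)
  (* the space, its Hilbert basis, the data *)
  (E : hilbertType R) (Psi : nat -> E)
  (hsep : separable_space E) (hPsi : hilbert_basis Psi)
  (dsp : measure_display) (Omega : measurableType dsp) (P : probability Omega R)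
  (X : {RV P >-> borel E}) (Y : {RV P >-> bool})
  (x : nat -> {RV P >-> borel E}) (y : nat -> {RV P >-> bool})
  (hid : forall n, identically_distributed P
     (fun t => (x n t, y n t) : labeled E) (fun t => (X t, Y t) : labeled E))
  (hind : mutually_independent P (fun (o : option nat) t =>
     if o is Some n then (x n t, y n t) : labeled E else (X t, Y t)))
  (B : set E) (hB : bounded_set B) (hXB : forall t, B (X t))
  (Om : forall d, set 'rV[R]_d)
  (hOm : forall d, (1 <= d)%N -> compact (Om d) /\ proj_coords Psi d @` B `<=` Om d)
  (* kernels with their feature maps, regularization bounds, penalties, sizes *)
  (J : forall d, set (kernel_fun R d)) (Cmax lambda : nat -> R) (l : nat -> nat)
  (H : forall d, kernel_fun R d -> hilbertType R)
  (phi : forall d (K : kernel_fun R d), 'rV[R]_d -> H d K)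
  (hJ : forall d K, (1 <= d)%N -> J d K ->
     [/\ psd_kernel K, borel_kernel K & feature_map K (phi d K)])
  (hlambda : forall d, (1 <= d)%N -> 0 <= lambda d)
  (hl : forall N, (2 <= N)%N -> (1 <= l N < N)%N)
  (* assumptions (i), (ii), (iii) *)
  (hfin : forall d, (1 <= d)%N -> finite_set (J d))
  (huniv : forall d, (1 <= d)%N -> exists K, [/\ J d K,
     universal_kernel (Om d) K (phi d K) &
     exists nu : R, 0 < nu /\ exists M : R, \forall e \near 0^'+,
       (covering_number (Om d) (phi d K) e <= (M * e `^ (- nu))%:E)%E])
  (hCmax : forall d, (1 <= d)%N -> 1 < Cmax d)
  (* summability of the penalties and growth of the training set *)
  (hsum : (\sum_(1 <= d <oo)
     (#|` fset_set (J d)|%:R * expR (- 2 * lambda d ^+ 2))%:E < +oo)%E)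
  (hlN : l @ \oo --> \oo)
  (hmN : (fun N => (N - l N)%N) @ \oo --> \oo)
  (hrate : (fun N => (l N)%:R * ln (N - l N)%:R / (N - l N)%:R : R)
     @ \oo --> (0 : R))
  (* the training procedure: sol N a s is the pair (w, b) trained on s *)
  (s0 : bool)
  (sol : forall N (a : svm_param R), (l N).-tuple (labeled E) ->
     H (par_dim a) (par_ker a) * R)
  (hsol : forall N a (s : (l N).-tuple (labeled E)), (2 <= N)%N -> param_set J Cmax a ->
     svm_solution (par_reg a)
       (fun i => phi (par_dim a) (par_ker a) (proj_coords Psi (par_dim a) (tnth s i).1))
       (fun i => (tnth s i).2) (sol N a s))
  (f : forall N, svm_param R -> (l N).-tuple (labeled E) -> E -> bool)
  (hf : forall N a s, f N a s =
     svm_classifier Psi s0 (phi (par_dim a) (par_ker a)) (sol N a s))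
  (hfmeas : forall N a, (2 <= N)%N -> param_set J Cmax a ->
     measurable_fun [set: (l N).-tuple (labeled E) * borel E]
       (fun p => f N a p.1 p.2))
  (* the selection of a^* on the validation set *)
  (astar : forall N, (l N).-tuple (labeled E) -> (N - l N).-tuple (labeled E) ->
     svm_param R)
  (hastar : forall N s v, (2 <= N)%N -> param_set J Cmax (astar N s v) /\
     forall a, param_set J Cmax a ->
       validation_error v (f N (astar N s v) s) +
         lambda (par_dim (astar N s v)) / Num.sqrt (N - l N)%:R
       <= validation_error v (f N a s) +
         lambda (par_dim a) / Num.sqrt (N - l N)%:R)
  (hfNmeas : forall N, (2 <= N)%N ->
     measurable_fun [set: (l N).-tuple (labeled E) *
                          (N - l N).-tuple (labeled E) * borel E]
       (fun p => f N (astar N p.1.1 p.1.2) p.1.1 p.2))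
  (eta : E -> R) (heta : cond_prob1 X Y eta) :
  (fun N => risk P X Y (fun t =>
     let z := fun i => (x i t, y i t) : labeled E in
     let s := data_block z 0 (l N) in
     let v := data_block z (l N) (N - l N) in
     f N (astar N s v) s)) @ \oo
  --> risk P X Y (fun _ => bayes_classifier eta).
Proof.
pose Z (o : option nat) (t : Omega) : labeled E :=
  if o is Some n then (x n t, y n t) else (X t, Y t).
have mZ o : measurable_fun [set: Omega] (Z o).
  by case: o => [n|]; apply: measurable_fun_pair.
have idZ i j : identically_distributed P (Z i) (Z j).
  have idN o : identically_distributed P (Z o) (Z None) by case: o => [n|]; [exact: hid|].
  by move=> A mA; rewrite (idN i A mA) (idN j A mA).
have indZ : mutually_independent P Z by exact: hind.
have ZN t : Z None t = (X t, Y t) by [].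
pose m N := (N - l N)%N.
pose str N t := sample Z (fun i : 'I_(l N) => Some (val i)) t.
pose sval N t := sample Z (fun i : 'I_(m N) => Some (l N + i)%N) t.
pose rN N : R := Pr P (fun t => f N (astar N (str N t) (sval N t)) (str N t) (X t) != Y t).
pose Ls : R := Pr P (fun t => bayes_classifier eta (X t) != Y t).
have mbayes : measurable_fun [set: Omega] (fun t => bayes_classifier eta (X t) != Y t).
  apply: (measurable_bool2 (fun a b => a != b)) => //.
  exact: (measurable_classif X (measurable_bayes heta)).
have merr (d : measure_display) (T : measurableType d) (g : T -> borel E -> bool) :
    measurable_fun [set: T * borel E] (fun p => g p.1 p.2) ->
    measurable_fun [set: T * labeled E] (fun p => g p.1 p.2.1 != p.2.2).
  move=> mg; apply: (measurable_bool2 (fun a b => a != b)); last exact: measurableT_comp.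
  have mp : measurable_fun [set: T * labeled E] (fun p => (p.1, p.2.1) : T * borel E).
    by apply: measurable_fun_pair; [exact: measurable_fst|exact: measurableT_comp].
  exact: (measurableT_comp mg mp).
have mstar N (N2 : (2 <= N)%N) : measurable_fun
    [set: (l N).-tuple (labeled E) * (m N).-tuple (labeled E) * labeled E]
    (fun p => f N (astar N p.1.1 p.1.2) p.1.1 p.2.1 != p.2.2).
  exact: (merr _ _ (fun q z => f N (astar N q.1 q.2) q.1 z) (hfNmeas N N2)).
have mrisk N (N2 : (2 <= N)%N) : measurable_fun [set: Omega]
    (fun t => f N (astar N (str N t) (sval N t)) (str N t) (X t) != Y t).
  have mp : measurable_fun [set: Omega] (fun t => (str N t, sval N t, Z None t)).
    apply: measurable_fun_pair => //.
    by apply: measurable_fun_pair; exact: measurable_sample.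
  exact: (measurableT_comp (mstar N N2) mp).
(* Given the data the selected classifier is a fixed measurable one, to which Bayes optimality
   applies. Both blocks are merged into one tuple to use [Pr_sample]. *)
have lower N : (2 <= N)%N -> Ls <= rN N.
  move=> N2; pose idx (i : 'I_(l N + m N)) := Some (val i).
  have inj : injective idx by move=> i j [] /val_inj.
  pose tr (w : (l N + m N).-tuple (labeled E)) : (l N).-tuple (labeled E) :=
    [tuple tnth w (lshift (m N) i) | i < l N].
  pose tv (w : (l N + m N).-tuple (labeled E)) : (m N).-tuple (labeled E) :=
    [tuple tnth w (rshift (l N) i) | i < m N].
  have trE t : tr (sample Z idx t) = str N t.
    by apply: eq_mktuple => i; rewrite tnth_sample.
  have tvE t : tv (sample Z idx t) = sval N t.
    by apply: eq_mktuple => i; rewrite tnth_sample.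
  have mtr : measurable_fun [set: (l N + m N).-tuple (labeled E)] (fun w => (tr w, tv w)).
    apply: measurable_fun_pair; apply/measurable_fun_tnthP => i.
      rewrite (_ : _ \o _ = @tnth _ _ ^~ (lshift (m N) i)); first exact: measurable_tnth.
      by apply/funext => w /=; rewrite tnth_mktuple.
    rewrite (_ : _ \o _ = @tnth _ _ ^~ (rshift (l N) i)); first exact: measurable_tnth.
    by apply/funext => w /=; rewrite tnth_mktuple.
  have mG : measurable_fun [set: (l N + m N).-tuple (labeled E) * labeled E]
      (fun p => f N (astar N (tr p.1) (tv p.1)) (tr p.1) p.2.1 != p.2.2).
    have mp : measurable_fun [set: (l N + m N).-tuple (labeled E) * labeled E]
        (fun p => (tr p.1, tv p.1, p.2)).
      apply: measurable_fun_pair; last exact: measurable_snd.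
      exact: (measurableT_comp mtr measurable_fst).
    exact: (measurableT_comp (mstar N N2) mp).
  have [bF FE] := Pr_sample mZ idZ indZ
    (G := fun w z => f N (astar N (tr w) (tv w)) (tr w) z.1 != z.2) inj
    (fun=> isT : Some _ != None) mG.
  have -> : rN N = Pr P (fun t => f N (astar N (tr (sample Z idx t)) (tv (sample Z idx t)))
      (tr (sample Z idx t)) (Z None t).1 != (Z None t).2).
    by congr Pr; apply/funext => t; rewrite trE tvE.
  rewrite FE -[leLHS](Ex_cst P); apply: Ex_le => [||t]; [exact: bmf_cst|exact: bF|].
  apply: (bayes_optimal heta).
  exact: (measurableT_comp (hfNmeas N N2) (measurable_pair1 (tr _, tv _))).
have XOm d t : (1 <= d)%N -> Om d (proj_coords Psi d (X t)).
  by move=> d1; apply: (proj2 (hOm d d1)); exists (X t) => //; exact: hXB.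
have upper e : 0 < e -> \forall N \near \oo, rN N <= Ls + e.
  (* Six errors: the hinge approximation, the training, the penalty of the competitor, t, the
     pattern count and 1/k. *)
  move=> e0; pose e1 := e / 6; have e10 : 0 < e1 by rewrite divr_gt0.
  have [d d1 dP] := hinge_risk_approx hPsi heta e10 XOm.
  have [K [JK uK _]] := huniv d d1.
  have [_ _ featK] := hJ d K d1 JK.
  have cphi : continuous (phi d K) := feature_continuous (proj1 uK) featK.
  have [w0 w0P] := dP K _ _ uK cphi.
  have [r r0 [L LP]] :=
    svm_risk_bound mZ idZ indZ ZN heta (proj1 (hOm d d1)) (fun t => XOm d t d1) cphi s0 w0 e10.
  have [W W0 WP] := model_penalty_sum hfin hlambda hsum.
  (* k depends on e alone, so k < m holds for N large. *)
  pose k := (Num.truncn e1^-1).+1.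
  have ke : k%:R^-1 <= e1.
    by rewrite invf_ple ?posrE ?ltr0n//; apply: ltW; exact: truncnS_gt.
  have t4 : 0 < e1 ^+ 2 / 4 by rewrite divr_gt0// exprn_gt0.
  have mN (q : R) : \forall N \near \oo, q <= (m N)%:R.
    have nq : \forall n \near \oo, (Num.truncn q < n)%N by exists (Num.truncn q).+1.
    have H0 : \forall N \near \oo, (Num.truncn q < m N)%N by exact: (hmN _ nq).
    by near=> N; rewrite (le_trans (ltW (truncnS_gt _)))// ler_nat; near: N.
  have lNq (q : R) : \forall N \near \oo, q <= (l N)%:R.
    have nq : \forall n \near \oo, (Num.truncn q < n)%N by exists (Num.truncn q).+1.
    have H0 : \forall N \near \oo, (Num.truncn q < l N)%N by exact: (hlN _ nq).
    by near=> N; rewrite (le_trans (ltW (truncnS_gt _)))// ler_nat; near: N.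
  near=> N.
  have N2 : (2 <= N)%N by near: N; exists 2%N.
  have /andP[l0 lN] := hl N N2.
  have lR : 0 < (l N)%:R :> R by rewrite ltr0n.
  have m0 : (0 < m N)%N by rewrite subn_gt0.
  have mR : 0 < (m N)%:R :> R by rewrite ltr0n.
  have LN : (L <= l N)%N by rewrite -(ler_nat R); near: N; exact: lNq.
  have rl : r ^+ 2 / (l N)%:R <= 1.
    by rewrite ler_pdivrMr// mul1r; near: N; exact: lNq.
  have km : (k.+1 <= m N)%N by rewrite -(ler_nat R); near: N; exact: mN.
  have rate : 4 * ((l N)%:R * ln (m N)%:R) <= e1 ^+ 2 * (m N)%:R.
    have : `|0 - (l N)%:R * ln (m N)%:R / (m N)%:R| <= e1 ^+ 2 / 4.
      by near: N; move/cvgrPdist_le: hrate => /(_ _ t4).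
    rewrite sub0r normrN => /(le_trans (ler_norm _)).
    by rewrite ler_pdivrMr//; lra.
  have We : (e1 ^+ 2 * (m N)%:R)^-1 * W <= e1.
    rewrite mulrC ler_pdivrMr ?mulr_gt0 ?exprn_gt0//.
    have : W / (e1 * e1 ^+ 2) <= (m N)%:R by near: N; exact: mN.
    by rewrite ler_pdivrMr ?mulr_gt0 ?exprn_gt0//; lra.
  have lam_e : lambda d / Num.sqrt (m N)%:R <= e1.
    rewrite ler_pdivrMr ?sqrtr_gt0// mulrC -ler_pdivrMr//.
    have le0 : 0 <= lambda d / e1 by rewrite divr_ge0 ?hlambda// ltW.
    rewrite -[leLHS]ger0_norm// -sqrtr_sqr ler_sqrt ?ler0n//.
    by near: N; exact: mN.
  (* The competitor; r^2 / l <= 1 < C_d makes it admissible. *)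
  pose a0 := SvmParam K (r ^+ 2 / (l N)%:R).
  have a0P : param_set J Cmax a0.
    split => //=; rewrite divr_ge0 ?sqr_ge0//=.
    by apply: le_trans rl _; apply: ltW; exact: hCmax.
  have r0N := LP (l N) LN (sol N a0) (f N a0) (fun s => hsol N a0 s N2 a0P)
    (fun s => hf N a0 s) (hfmeas N a0 N2 a0P).
  have patP s (T : finType) (w : T -> labeled E) (mu : model R) :
      exists2 Ls : seq {ffun T -> bool}, (size Ls <= #|T|.+1 ^ (l N).+1)%N &
      forall a, param_set J Cmax a -> model_of a = mu ->
        [ffun p => f N a s (w p).1 != (w p).2] \in Ls.
    have [Lp sL LpP] := svm_pattern_cover Psi s0 (phi (tag mu) (tagged mu)) s w.
    exists Lp => // a aP; rewrite hf => amu; move: Lp sL LpP.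
    by rewrite -amu => Lp sL LpP; apply: (LpP (par_reg a)); exact: hsol.
  have patP' s (w : 'I_(m N) * 'I_k -> labeled E) mu :
      exists2 Lp : seq {ffun 'I_(m N) * 'I_k -> bool},
        (size Lp <= (m N * k).+1 ^ (l N).+1)%N &
        forall a, param_set J Cmax a -> model_of a = mu ->
          [ffun p => f N a s (w p).1 != (w p).2] \in Lp.
    by have := patP s _ w mu; rewrite card_prod !card_ord.
  have sumP (mus : seq (model R)) :
      (forall mu, mu \in mus -> exists2 a, param_set J Cmax a & model_of a = mu) ->
      exists ms : seq (model R), [/\ {subset mus <= ms},
        forall mu, mu \in ms -> 0 <= lambda (tag mu) / Num.sqrt (m N)%:R &
        \sum_(mu <- ms) expR (- 2 * (m N)%:R * (lambda (tag mu) / Num.sqrt (m N)%:R) ^+ 2) <= W].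
    by move=> musP; apply: WP => // mu /musP[a [? ? _] <-].
  have k0 : (0 < k)%N by [].
  have := selection_risk (mdl := @model_of R) (adm := param_set J Cmax)
    (Lam := fun mu => lambda (tag mu) / Num.sqrt (m N)%:R)
    (err := fun a s z => f N a s z.1 != z.2) mZ idZ indZ m0 k0 (mstar N N2)
    (merr _ _ (f N a0) (hfmeas N a0 N2 a0P)) (fun s v => proj1 (hastar N s v N2))
    (fun s v => proj2 (hastar N s v N2) a0 a0P) patP' sumP (ltW e10).
  move=> sel.
  pose Q : R := ((m N * k).+1 ^ (l N).+1)%:R * expR (- 2 * (m N)%:R * e1 ^+ 2) * W.
  pose R0 : R := Pr P (fun t => f N a0 (str N t) (X t) != Y t).
  pose A0 : R := Ex P (fun t => hinge (label_value R (Y t) *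
    (inner (H d K) w0 (phi d K (proj_coords Psi d (X t))) + 0))).
  have Qe : Q <= e1.
    exact: le_trans (ler_wpM2r W0 (pattern_exp_bound l0 km e10 rate)) We.
  have {}sel : rN N <= R0 + lambda d / Num.sqrt (m N)%:R + e1 + Q + k%:R^-1 := sel.
  have {}r0N : R0 + Ls <= A0 + e1 := r0N.
  have {}w0P : A0 <= 2 * Ls + e1 := w0P.
  have -> : e = 6 * e1 by rewrite /e1; field.
  (* From R0 + Ls <= A0 + e1 and A0 <= 2 Ls + e1, one copy of Ls cancels and R0 <= Ls + 2 e1. *)
  move: sel r0N w0P Qe ke lam_e.
  move: (rN N) R0 A0 Q (k%:R^-1) (lambda d / _) => *; lra.
have rNcvg : rN @ \oo --> Ls.
  apply/cvgrPdist_le => e e0; near=> N.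
  have N2 : (2 <= N)%N by near: N; exists 2%N.
  rewrite distrC ger0_norm ?subr_ge0 ?lower// lerBlDl addrC [leRHS]addrC.
  by near: N; exact: upper.
have -> : risk P X Y (fun _ => bayes_classifier eta) = Ls%:E by rewrite /risk PrE.
apply: cvg_EFin; last first.
  by apply: cvg_trans rNcvg; apply: near_eq_cvg; exact: nearW.
exists 2%N => // N /= N2; apply: fin_num_measure; exact: (measurable_event (mrisk N N2)).
Unshelve. all: by end_near. Qed.
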